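(* In the setting described in the context, for every $x\in\mathcal X$ and every $0<\delta\le\bar\delta$, $$\operatorname{dist}\big(g_\delta(x),\partial^c\tilde\varphi(x)\big)\le\|d_y(x)\|\,\omega_y^c(x,\delta).$$ Consequently, for every fixed $x\in\mathcal X$, $\operatorname{dist}\big(g_\delta(x),\partial^c\tilde\varphi(x)\big)\to0$ as $\delta\downarrow0$.
   Context: Norms: Euclidean for vectors, the induced operator (spectral) norm for matrices; $\operatorname{dist}(z,\mathcal S)=\inf_{s\in\mathcal S}\|z-s\|$. $\mathbb B_n$ is the closed unit ball of $\mathbb R^n$. Response mapping. $\mathcal X\subset\mathbb R^n$ is nonempty and compact. $\mathcal N$ is an open set containing $\mathcal X$. For each $x\in\mathcal N$ the lower-level solution set $S(x)=\arg\min_{\xi\in\mathcal Y}g(x,\xi)$ (with $\mathcal Y\subseteq\mathbb R^m$) is a singleton $\{y(x)\}$, and the response map $y:\mathcal N\to\mathbb R^m$ is locally Lipschitz. A number $\bar\delta>0$ with $\mathcal X_{\bar\delta}:=\mathcal X+\bar\delta\mathbb B_n\subseteq\mathcal N$ is fixed; on $\mathcal X_{\bar\delta}$, $y$ is bounded in norm by $Y_{\max}$ and $L_y$-Lipschitz. Smoothing. For $0<\delta\le\bar\delta$, $y_\delta(u)=\mathbb E_{\xi\sim\mathrm{Unif}(\mathbb B_n)}[y(u+\delta\xi)]$ (defined for $u$ in a neighborhood of $\mathcal X$, where it is continuously differentiable), with Jacobian $\mathrm Jy_\delta(u)\in\mathbb R^{m\times n}$. Upper-level objective. $\varphi\in C^1(\mathbb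 R^n\times\mathbb R^m)$ with partial gradients $\nabla_1\varphi$ (in $x$) and $\nabla_2\varphi$ (in $y$). There are finite constants $L_{1x},L_{1y},L_{2x},L_{2y},M_y>0$ such that for all $(x,y),(x',y')\in W$: $\|\nabla_1\varphi(x,y)-\nabla_1\varphi(x',y')\|\le L_{1x}\|x-x'\|+L_{1y}\|y-y'\|$, $\|\nabla_2\varphi(x,y)-\nabla_2\varphi(x',y')\|\le L_{2x}\|x-x'\|+L_{2y}\|y-y'\|$, $\|\nabla_2\varphi(x,y)\|\le M_y$. Here $W\subseteq\mathbb R^n\times\mathbb R^m$ is a set containing all pairs $(x,y(x))$ and $(x,y_\delta(x))$ with $x\in\mathcal X$, $0<\delta\le\bar\delta$. Reduced hyperobjective: $\tilde\varphi(x)=\varphi(x,y(x))$ on $\mathcal N$. Notation: $d_x(x)=\nabla_1\varphi(x,y(x))$, $d_y(x)=\nabla_2\varphi(x,y(x))$. Bi-ZOL approximate hypergradient: $g_\delta(x)=d_x(x)+\mathrm Jy_\delta(x)^\top d_y(x)$. Clarke objects. For a locally Lipschitz map $F$ on an open set, differentiable exactly on the full-measure set $\Omega_F$, $\mathrm J^cF(x)=\operatorname{conv}\{\lim_k \mathrm JF(x^k): x^k\to x,\ x^k\in\Omega_F\}$; for scalar $f$, $\partial^cf(x)=\operatorname{conv}\{\lim_k\nabla f(x^k):x^k\to x,\ x^k\in\Omega_f\}$. Local set variation of the Clarke generalized Jacobian: $\omega_y^c(x,\delta)=\sup_{\|s-x\|\le\delta}\ \sup_{V\in\mathrm J^cy(s)}\operatorname{dist}\big(V,\mathrm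 J^cy(x)\big)$. *)

(* Defs.v *)
(* MathComp-Analysis; R : realType throughout. *)
From HB Require Import structures.
From mathcomp Require Import all_boot all_order all_algebra.
From mathcomp Require Import all_classical all_reals all_analysis.
Set Implicit Arguments.
Unset Strict Implicit.
Unset Printing Implicit Defensive.
Import Order.TTheory GRing.Theory Num.Theory.
Import numFieldNormedType.Exports.
Local Open Scope classical_set_scope.
Local Open Scope ring_scope.

(* Vectors of R^n are row vectors 'rV[R]_n, whose library norm is the sup norm;
   topology and differentiability do not depend on the choice of norm, but all
   metric quantities below use the Euclidean one. *)
Section norms.
Context {R : realType}.

Definition enorm n (x : 'rV[R]_n) : R := Num.sqrt (\sum_i x 0 i ^+ 2).

Definition eball n (x : 'rV[R]_n) (r : R) : set 'rV[R]_n :=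
  [set u | enorm (u - x) <= r].

(* [x *m A^T] is the row vector (A x^T)^T. *)
Definition opnorm m n (A : 'M[R]_(m, n)) : R :=
  sup [set enorm (x *m A^T) | x in eball (0 : 'rV[R]_n) 1].

(* Extended-real valued, so that the distance to the empty set is +oo. *)
Definition set_dist (V : zmodType) (N : V -> R) (z : V) (S : set V) : \bar R :=
  ereal_inf [set (N (z - s))%:E | s in S].

Definition conv_hull (V : lmodType R) (A : set V) : set V :=
  \bigcap_(C in [set C : set V | convex_set C /\ A `<=` C]) C.

Definition locally_lipschitz n m (N : set 'rV[R]_n) (F : 'rV[R]_n -> 'rV[R]_m) :=
  forall x, N x ->
    exists k : R, \forall u & v \near x, enorm (F u - F v) <= k * enorm (u - v).

End norms.

Section clarke.
Context {R : realType}.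

(* The library's ['J F x] acts on row vectors on the right; the m x n matrix
   (dF_i/dx_j) is its transpose. *)
Definition Jac n m (F : 'rV[R]_n -> 'rV[R]_m) (x : 'rV[R]_n) : 'M[R]_(m, n) :=
  ('J F x)^T.

Definition grad n (f : 'rV[R]_n -> R) (x : 'rV[R]_n) : 'rV[R]_n :=
  \row_j 'D_(delta_mx 0 j) f x.

(* Values of [F] outside the open domain [N] are irrelevant. *)
Definition clarke_jac n m (N : set 'rV[R]_n) (F : 'rV[R]_n -> 'rV[R]_m)
    (x : 'rV[R]_n) : set 'M[R]_(m, n) :=
  conv_hull [set V : 'M[R]_(m, n) | exists xk : nat -> 'rV[R]_n,
    [/\ forall k, N (xk k) /\ differentiable F (xk k),
        xk k @[k --> \oo] --> x
      & Jac F (xk k) @[k --> \oo] --> V]].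

Definition clarke_subdiff n (N : set 'rV[R]_n) (f : 'rV[R]_n -> R)
    (x : 'rV[R]_n) : set 'rV[R]_n :=
  conv_hull [set v : 'rV[R]_n | exists xk : nat -> 'rV[R]_n,
    [/\ forall k, N (xk k) /\ differentiable f (xk k),
        xk k @[k --> \oo] --> x
      & grad f (xk k) @[k --> \oo] --> v]].

Definition clarke_variation n m (N : set 'rV[R]_n) (F : 'rV[R]_n -> 'rV[R]_m)
    (x : 'rV[R]_n) (delta : R) : \bar R :=
  ereal_sup [set ereal_sup [set set_dist (@opnorm _ m n) V (clarke_jac N F x)
                           | V in clarke_jac N F s]
            | s in eball x delta].

End clarke.

(* n-dimensional Lebesgue measure on n-tuples of reals, as the n-fold product
   of the one-dimensional one. *)
Section lebesgue_tuple.
Context {R : realType}.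
Local Notation T := (measurableTypeR R).
Local Open Scope ereal_scope.

Definition consT n (p : T * n.-tuple T) : n.+1.-tuple T :=
  [tuple of p.1 :: p.2].

Lemma measurable_consT n : measurable_fun [set: T * n.-tuple T] (@consT n).
Proof. by apply: (@measurable_cons _ _ _ T fst n snd). Qed.

Section step.
Variables (n : nat) (mu : {sigma_finite_measure set (n.-tuple T) -> \bar R}).

Definition lebesgue_cons : set (n.+1.-tuple T) -> \bar R :=
  pushforward (lebesgue_measure \x mu) (@consT n).

Let lebesgue_cons0 : lebesgue_cons set0 = 0.
Proof. by rewrite /lebesgue_cons /pushforward preimage_set0 measure0. Qed.

Let lebesgue_cons_ge0 A : 0 <= lebesgue_cons A.
Proof. by rewrite /lebesgue_cons /pushforward measure_ge0. Qed.

Let lebesgue_cons_sigma_additive : semi_sigma_additive lebesgue_cons.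
Proof.
move=> F mF tF mUF; rewrite /lebesgue_cons /pushforward preimage_bigcup.
apply: measure_semi_sigma_additive.
- by move=> i; rewrite -[X in measurable X]setTI; exact: measurable_consT.
- apply/trivIsetP => i j _ _ ij; rewrite -preimage_setI.
  by move/trivIsetP : tF => -> //; rewrite preimage_set0.
- rewrite -preimage_bigcup -[X in measurable X]setTI.
  exact: measurable_consT.
Qed.

HB.instance Definition _ := isMeasure.Build _ _ _ lebesgue_cons
  lebesgue_cons0 lebesgue_cons_ge0 lebesgue_cons_sigma_additive.

Let lebesgue_cons_sigma_finite : sigma_finite setT lebesgue_cons.
Proof.
have /sigma_finiteP[F [TF ndF Foo]] :=
  sigma_finiteT (@lebesgue_measure R : {sigma_finite_measure set T -> \bar R}).
have /sigma_finiteP[G [TG ndG Goo]] := sigma_finiteT mu.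
pose H k := [set t : n.+1.-tuple T | F k (thead t) /\ G k [tuple of behead t]].
exists H.
  apply/seteqP; split => // t _.
  have [i _ Fi] : (\bigcup_k F k) (thead t) by rewrite -TF.
  have [j _ Gj] : (\bigcup_k G k) [tuple of behead t] by rewrite -TG.
  exists (maxn i j) => //; split.
    by apply: (subsetPset _ _ (ndF _ _ (leq_maxl i j))).
  by apply: (subsetPset _ _ (ndG _ _ (leq_maxr i j))).
move=> k; have [mF Fk] := Foo k; have [mG Gk] := Goo k; split.
  apply: measurableI; rewrite -[X in measurable X]setTI.
    exact: (measurable_tnth ord0).
  exact: measurable_behead.
rewrite /lebesgue_cons /pushforward (_ : _ @^-1` _ = F k `*` G k).
  by rewrite product_measure1E// lte_mul_pinfty// ge0_fin_numE.
have consK a t : [tuple of behead (consT (a, t))] = t by apply/val_inj.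
by apply/seteqP; split => -[a t] [] /=; rewrite /H /= consK theadE.
Qed.

HB.instance Definition _ := @Measure_isSigmaFinite.Build _ _ _ lebesgue_cons
  lebesgue_cons_sigma_finite.

End step.

Fixpoint lebesgue_tuple n : {sigma_finite_measure set (n.-tuple T) -> \bar R} :=
  match n with
  | 0 => \d_([tuple] : 0.-tuple T)
  | n'.+1 => lebesgue_cons (lebesgue_tuple n')
  end.

Definition row_of_tuple n (t : n.-tuple T) : 'rV[R]_n := \row_i tnth t i.

Lemma lebesgue_tuple_box n (A : 'I_n -> set T) :
  (forall i, measurable (A i)) ->
  lebesgue_tuple n [set t | forall i, A i (tnth t i)] =
  \prod_(i < n) lebesgue_measure (A i).
Proof.
elim: n A => [|n IHn] A mA.
  by rewrite big_ord0 /= diracE mem_set// => -[].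
rewrite big_ord_recl -IHn//= /lebesgue_cons /pushforward.
pose B := [set t : n.-tuple T | forall i, A (lift ord0 i) (tnth t i)].
rewrite (_ : _ @^-1` _ = A ord0 `*` B); last first.
  apply/seteqP; split => [[a t] /= At|[a t] /= [Aa Bt] i].
    by split => [|i]; [exact: (At ord0)|have := At (lift ord0 i); rewrite tnthS].
  by case: (unliftP ord0 i) => [j ->|->] //; rewrite tnthS; exact: Bt.
rewrite product_measure1E//.
rewrite (_ : B = \bigcap_(i in [set: 'I_n]) ((@tnth n T)^~ i @^-1` A (lift ord0 i))).
  apply: fin_bigcap_measurable => [|i _]; first exact: finite_finset.
  by rewrite -[X in measurable X]setTI; exact: measurable_tnth.
by apply/seteqP; split => t /= Bt i => [_|]; exact: Bt.
Qed.

End lebesgue_tuple.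

Section smoothing.
Context {R : realType}.

(* Expectation of [f] under the uniform distribution on the closed unit ball. *)
Definition unif_ball_mean n (f : 'rV[R]_n -> R) : R :=
  let B := [set t | eball 0 1 (row_of_tuple t)] in
  (fine (lebesgue_tuple n B))^-1 *
  \int[lebesgue_tuple n]_(t in B) f (row_of_tuple t).

Definition smoothing n m (y : 'rV[R]_n -> 'rV[R]_m) (delta : R)
    (u : 'rV[R]_n) : 'rV[R]_m :=
  \row_j unif_ball_mean (fun xi => y (u + delta *: xi) 0 j).

End smoothing.

Section bilevel.
Context {R : realType} {n m : nat}.
Variables (phi : 'rV[R]_n -> 'rV[R]_m -> R) (y : 'rV[R]_n -> 'rV[R]_m).

Definition argmin (Y : set 'rV[R]_m) (h : 'rV[R]_m -> R) : set 'rV[R]_m :=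
  [set xi | Y xi /\ forall z, Y z -> h xi <= h z].

Definition thickening (X : set 'rV[R]_n) (r : R) : set 'rV[R]_n :=
  [set x + r *: b | x in X & b in eball 0 1].

Definition grad1 (x : 'rV[R]_n) (v : 'rV[R]_m) : 'rV[R]_n :=
  grad (phi ^~ v) x.

Definition grad2 (x : 'rV[R]_n) (v : 'rV[R]_m) : 'rV[R]_m :=
  grad (phi x) v.

Definition C1 : Prop :=
  [/\ forall p, differentiable (fun q : 'rV[R]_n * 'rV[R]_m => phi q.1 q.2) p,
      continuous (fun q : 'rV[R]_n * 'rV[R]_m => grad1 q.1 q.2)
    & continuous (fun q : 'rV[R]_n * 'rV[R]_m => grad2 q.1 q.2)].

Definition hyperobjective (x : 'rV[R]_n) : R := phi x (y x).

Definition dx (x : 'rV[R]_n) : 'rV[R]_n := grad1 x (y x).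

Definition dy (x : 'rV[R]_n) : 'rV[R]_m := grad2 x (y x).

(* [dy x *m J] is the row vector of J^T d_y(x). *)
Definition approx_hypergrad (delta : R) (x : 'rV[R]_n) : 'rV[R]_n :=
  dx x + dy x *m Jac (smoothing y delta) x.

End bilevel.

(* Main.v *)
(* By Rademacher's theorem, the Jacobian of the smoothed map at x is the mean,
   over the ball of radius delta around x, of the Jacobians of y at the points of
   differentiability. A mean of points of a convex set lies in its closure, so
   dy * Jac (smoothing y delta) x is within |dy| omega of the set dy * J^c y(x),
   and by the chain rule dx + dy * J^c y(x) is contained in the Clarke
   subdifferential of the hyperobjective. The limit follows since compactness of
   bounded sets of Jacobians makes J^c y upper semicontinuous at x.

   Rademacher's theorem is proved by induction on the dimension. At almost every
   point f has a first-order expansion both in the first coordinate and in the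
   remaining ones (Fubini). The points where given expansions hold with a given
   precision form a closed set A, and by Lebesgue's density theorem almost every
   point v of A is such that v + (s, 0) is within o(|s|) of A; moving first along
   the first coordinate inside A and then along the others combines the two
   partial expansions into a total one. *)
Require Import Defs.
From HB Require Import structures.
From mathcomp Require Import all_boot all_order all_algebra.
From mathcomp Require Import all_classical all_reals all_analysis.
From mathcomp Require Import measurable_realfun ring lra.
Set Implicit Arguments.
Unset Strict Implicit.
Unset Printing Implicit Defensive.
Import Order.TTheory GRing.Theory Num.Theory.
Import numFieldNormedType.Exports.
Local Open Scope classical_set_scope.
Local Open Scope ring_scope.

(** * Lipschitz functions of one variable *)

(** The response is only locally Lipschitz on [N], whereas measurability, domination and
    Rademacher's theorem are handled for globally Lipschitz functions. So [y] is replaced by a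
    McShane extension of its restriction to a neighbourhood of the closed ball; near [x] this
    changes neither the smoothing nor the Jacobians at points of the ball. Means are never placed
    inside a convex set, since closedness of the Clarke Jacobian is not established: each membership
    holds up to an arbitrary error, which the distance absorbs at the end. Likewise no hull is
    described by explicit convex combinations: to include a hull in a convex set it suffices to
    include its generators, so the target is always enlarged to a convex neighbourhood. The
    one-dimensional ingredient of Rademacher's theorem comes from Stieltjes measures: adding a
    linear function makes [f] monotone, and Lipschitz continuity makes the associated measure
    absolutely continuous. Topology and differentiability live in the sup norm, which is why
    dimension factors appear next to Lipschitz constants. *)

Section lipschitz_1d.
Context {R : realType}.
Local Notation mu := (@lebesgue_measure R).

(** Both sides are infima over the same covers by half-open intervals, so the comparison of interval
    lengths transfers cover by cover, for arbitrary sets. *)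
Lemma lebesgue_stieltjes_measure_le (g : cumulative R R) (k : R) : 0 < k ->
  (forall a b, a <= b -> g b - g a <= k * (b - a)) ->
  forall A : set R,
    (lebesgue_stieltjes_measure g A <= k%:E * lebesgue_measure A)%E.
Proof.
move=> k0 gk A.
have wle (B : set R) : ocitv B -> (wlength g B <= k%:E * wlength idfun B)%E.
  move/ocitvP => [->|[[a b] /= ab ->]]; first by rewrite !wlength0 mule0.
  rewrite (wlength_itv_bnd g _ _ (ltW ab)) (wlength_itv_bnd idfun _ _ (ltW ab)).
  by rewrite -EFinM lee_fin gk// ltW.
rewrite /lebesgue_measure /lebesgue_stieltjes_measure /measure_extension /mu_ext.
rewrite -ereal_inf_pZl//.
apply: le_ereal_inf_tmp => _ [_ [F [mF AF] <-] <-].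
apply: ge_ereal_inf.
exists (\sum_(i <oo) wlength g (F i))%E; first by exists F.
rewrite -nneseriesZl//.
by apply: lee_nneseries => i *; [exact: wlength_ge0|apply: wle; exact: mF].
Qed.

Lemma lebesgue_stieltjes_measure_ocitv (g : cumulative R R) (a b : R) :
  a <= b -> lebesgue_stieltjes_measure g `]a, b]%classic = (g b - g a)%:E.
Proof.
move=> ab; rewrite /lebesgue_stieltjes_measure /measure_extension.
by rewrite measurable_mu_extE; [exact: wlength_itv_bnd|exact: is_ocitv].
Qed.

(** [f] plus [L] times the identity is nondecreasing. Its Stieltjes measure is dominated by a
    multiple of Lebesgue measure, so it has a Radon-Nikodym density; locally the function is an
    indefinite integral, derivable almost everywhere by the Lebesgue form of the fundamental theorem
    of calculus. *)
Lemma lipschitz_ae_derivable (f : R -> R) (L : R) :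
  (forall x y, `|f x - f y| <= L * `|x - y|) ->
  {ae mu, forall x, derivable f x 1}.
Proof.
move=> fL.
have L0 : 0 <= L.
  by have := fL 0 1; rewrite sub0r normrN normr1 mulr1; exact: le_trans.
pose g x := f x + L * x.
have g_nd : nondecreasing g.
  move=> x y xy; rewrite /g -subr_ge0.
  have := fL x y; rewrite (distrC x) (@ger0_norm _ (y - x)) ?subr_ge0//.
  by rewrite ler_norml => /andP[]; lra.
(* The extra 1 keeps the constant positive when [L = 0], so that it can be divided by. *)
have g_lip a b : a <= b -> g b - g a <= (2 * L + 1) * (b - a).
  move=> ab; have := fL b a; rewrite (@ger0_norm _ (b - a)) ?subr_ge0//.
  by rewrite ler_norml /g => /andP[]; nra.
have g_cont : continuous g.
  move=> x; apply/cvgrPdist_le => e e0; near=> y.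
  have : `|x - y| <= e / (2 * L + 1).
    by near: y; apply: cvgr_dist_le => //; apply: divr_gt0 => //; lra.
  rewrite ler_pdivlMr; last by lra.
  apply: le_trans; rewrite mulrC.
  have key a b : a <= b -> `|g b - g a| <= (2 * L + 1) * `|b - a|.
    by move=> ab; rewrite !ger0_norm ?subr_ge0// ?g_lip// g_nd.
  have [/key|/ltW/key //] := leP x y.
  by rewrite distrC (distrC y).
pose G : cumulative R R := HB.pack g
  (isCumulative.Build R _ R g g_nd (right_continuousW g_cont)).
have dG : lebesgue_stieltjes_measure G `<< mu.
  apply/null_content_dominatesP => A mA A0; apply/eqP; rewrite -measure_le0.
  have k0 : 0 < 2 * L + 1 by lra.
  have := lebesgue_stieltjes_measure_le (g := G) k0 g_lip A.
  by rewrite A0 mule0.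
(* Bounded windows make the restricted measure finite and its density integrable; countably many of
   them cover the line. *)
suff H (k : nat) : {ae mu, forall x, `]- k%:R, k%:R[%classic x -> derivable f x 1}.
  have := ae_foralln H; apply: filterS => x Hx.
  apply: (Hx (Num.truncn `|x|).+1); rewrite /= in_itv/=.
  by rewrite -ltr_norml Num.Theory.truncnS_gt.
pose D := `]- k%:R, k%:R]%classic : set R.
have mD : measurable D by exact: measurable_itv.
have Doo : (lebesgue_stieltjes_measure G D < +oo)%E.
  have k0 : 0 < 2 * L + 1 by lra.
  apply: (le_lt_trans (lebesgue_stieltjes_measure_le (g := G) k0 g_lip D)).
  rewrite lebesgue_measure_itv/=; case: ifP => _; last by rewrite mule0.
  by rewrite -EFinB -EFinM ltry.
pose nu : {finite_measure set (measurableTypeR R) -> \bar R} :=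
  @mfrestr _ (measurableTypeR R) R D (lebesgue_stieltjes_measure G) mD Doo.
have dnu : nu `<< mu.
  apply/null_content_dominatesP => A mA A0.
  apply/eqP; rewrite -measure_le0 /nu /mfrestr /mrestr.
  apply: le_trans (measureIl _ mA mD) _.
  move/null_content_dominatesP : dG => /(_ _ mA A0) H.
  by rewrite -H.
have [h [h0 hfin hint hnu]] :
  exists h : R -> \bar R, [/\ forall x, (h x >= 0)%E, forall x, h x \is a fin_num,
    mu.-integrable [set: R] h &
    forall A, measurable A -> nu A = (\int[mu]_(x in A) h x)%E].
  exact: (@radon_nikodym_sigma_finite _ (measurableTypeR R) R mu nu dnu).
have hE : h = EFin \o (fine \o h) by apply/funext => x /=; rewrite fineK.
have hint' (y : R) : mu.-integrable [set` Interval (BRight (- k%:R)) (BRight y)] (EFin \o (fine \o h)).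
  by rewrite -hE; apply: integrableS hint.
have hloc : locally_integrable [set: R] (fine \o h).
  by apply: open_integrable_locally; [exact: openT|rewrite -hE].
have := FTC1 hint' hloc.
apply: filterS; first exact: (ae_filter_ringOfSetsType mu).
move=> x H.
rewrite /= in_itv/= => /andP[kx xk].
have [dF _] := H kx.
have dlin : derivable (fun z : R => L * z) x 1.
  by apply: derivableM; [exact: derivable_cst|exact: derivable_id].
suff dg : derivable g x 1.
  have -> : f = g - (fun x => L * x) by apply/funext => z; rewrite /g !fctE addrK.
  exact: (derivableB dg dlin).
(* Inside the window [g] equals this function: its increment from [- k] is the measure of an
   interval, hence the integral of the density. *)
have dF' : derivable (cst (g (- k%:R)) + (fun y =>
    \int[mu]_(t in [set` Interval (BRight (- k%:R)) (BRight y)]) (fine \o h) t)) x 1.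
  exact: (derivableD (derivable_cst _ _ _) dF).
apply: near_eq_derivable dF'; near=> y.
rewrite !fctE /=.
have ky : - k%:R <= y by near: y; exact: lt_le_nbhsr.
have yk : y <= k%:R by near: y; exact: lt_le_nbhsl.
rewrite /Rintegral.
have := hnu `]- k%:R, y]%classic (measurable_itv _).
rewrite [h in RHS]hE => <-.
have -> : nu `]- k%:R, y]%classic = (g y - g (- k%:R))%:E.
  rewrite -(lebesgue_stieltjes_measure_ocitv G ky).
  rewrite /nu /= /mfrestr /mrestr setIidl// => z /=.
  by rewrite /D /= !in_itv/= => /andP[-> zy]; rewrite (le_trans zy).
by rewrite /= addrC subrK.
Unshelve. all: by end_near. Qed.
End lipschitz_1d.

(** * Rademacher's theorem *)

Lemma mul_invS_lt {R : archiRealFieldType} (c e : R) : 0 < c -> 0 < e ->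
  exists k : nat, c * k.+1%:R^-1 < e.
Proof.
move=> c0 e0; exists (Num.truncn (c / e)).
by rewrite ltr_pdivrMr// mulrC -ltr_pdivrMr//; exact: Num.Theory.truncnS_gt.
Qed.

(** * Borel sets of rows as measurable sets of tuples *)

Section tuple_borel.
Context {R : realType}.
Local Notation T := (measurableTypeR R).

Lemma ler_row_norm n (v : 'rV[R]_n) (r : R) : 0 <= r ->
  (`|v| <= r) = [forall i, `|v 0 i| <= r].
Proof.
move=> r0; rewrite [`|v|]mx_normrE; apply/bigmax_leP/forallP => [[_ H] i|H].
  exact: (H (0, i)).
by split => // -[i j] _ /=; rewrite (ord1 i).
Qed.

Lemma row_coord_le n (v : 'rV[R]_n) i : `|v 0 i| <= `|v|.
Proof.
have := lexx `|v|; rewrite ler_row_norm// => /forallP; exact.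
Qed.

(** The tuple sigma-algebra is a product, so an open set has to be written as a countable union of
    boxes: those with rational centre and radius [1/(k+1)] that lie inside it. *)
Lemma measurable_row_open n (U : set 'rV[R]_n) : open U ->
  measurable [set t : n.-tuple T | U (row_of_tuple t)].
Proof.
move=> oU.
pose box (q : n.-tuple rat * nat) : set (n.-tuple T) :=
  \bigcap_(i in [set: 'I_n])
    (@tnth n T)^~ i @^-1` (ball (ratr (tnth q.1 i) : R) q.2.+1%:R^-1).
have mbox q : measurable (box q).
  apply: fin_bigcap_measurable => [|i _]; first exact: finite_finset.
  rewrite -[X in measurable X]setTI.
  by apply: measurable_tnth => //; rewrite ball_itv; exact: measurable_itv.
rewrite (_ : [set t | _] = \bigcup_q
    (if `[< box q `<=` (fun t => U (row_of_tuple t)) >] then box q else set0)).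
  apply: countable_bigcupT_measurable => // q.
  by case: ifP => _; [exact: mbox|exact: measurable0].
apply/seteqP; split => t; last first.
  by move=> [q _]; case: asboolP => // H Hq; exact: H.
move=> /= Ut.
have /nbhs_ballP[e /= e0 He] : nbhs (row_of_tuple t) U by exact: open_nbhs_nbhs.
have [k ke] : exists k : nat, 2 * k.+1%:R^-1 < e by exact: mul_invS_lt.
have k0 : 0 < k.+1%:R^-1 :> R by rewrite invr_gt0.
have qP i : exists q : rat, `|ratr q - tnth t i| < k.+1%:R^-1.
  have /rat_in_itvoo[q] : tnth t i < tnth t i + k.+1%:R^-1 by rewrite ltrDl.
  rewrite in_itv/= => /andP[q1 q2]; exists q.
  by rewrite gtr0_norm ?subr_gt0// ltrBlDl.
have [q Hq] := choice qP.
exists ([tuple q i | i < n], k) => //.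
have bt : box ([tuple q i | i < n], k) t.
  by move=> i _ /=; rewrite tnth_mktuple; exact: Hq.
case: asboolP => // nH; exfalso; apply: nH => s Hs; apply: He; split => // a i.
rewrite !mxE.
have := Hs i Logic.I; rewrite /= tnth_mktuple /ball/= => si.
rewrite -(subrK (ratr (q i)) (tnth t i)) -addrA.
rewrite (le_lt_trans (ler_normD _ _))//.
rewrite (lt_trans _ ke)// mulr_natl mulr2n ltrD// distrC; exact: Hq.
Qed.

Lemma measurable_row_closed n (U : set 'rV[R]_n) : closed U ->
  measurable [set t : n.-tuple T | U (row_of_tuple t)].
Proof.
move=> cU; rewrite (_ : mkset _ = ~` [set t | (~` U) (row_of_tuple t)]).
  by apply: measurableC; apply: (@measurable_row_open _ (~` U)); exact: closed_openC.
by rewrite -[LHS]setCK.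
Qed.

Lemma measurable_fun_row n (f : 'rV[R]_n -> R) : continuous f ->
  measurable_fun [set: n.-tuple T] (f \o @row_of_tuple R n).
Proof.
move=> cf; apply: (measurability _ (@RGenOpens.measurableE R)).
move=> _ [_ [a [b ->]] <-]; rewrite setTI.
apply: (@measurable_row_open _ (f @^-1` `]a, b[%classic)).
by apply: open_comp => // x _; exact: cf.
Qed.
End tuple_borel.

(** * Lebesgue density on the line *)

Section density.
Context {R : realType}.
Local Notation mu := (@lebesgue_measure R).

(** If [A] missed the ball of radius [|s|/(l+1)] around [a + s], it would miss a fixed fraction of
    the ball of radius [3|s|] around [a]. That is impossible for small [s] at a point of density
    1. *)
Lemma ae_density_hits (A : set R) (l : nat) : measurable A ->
  {ae mu, forall a, A a -> exists k : nat, forall s, `|s| < k.+1%:R^-1 ->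
    exists2 s', `|s' - s| <= `|s| / l.+1%:R & A (a + s')}.
Proof.
move=> mA; have := lebesgue_density mA.
apply: filterS; first exact: (ae_filter_ringOfSetsType mu).
move=> a /fine_cvgP[_ +] Aa; rewrite indicE mem_set// => H.
(* The hole has length [2|s|/(l+1)] in a ball of length [6|s|], so it removes the fraction
   [1/(3(l+1))]. *)
pose c : R := 1 - (3 * l.+1%:R)^-1.
have c1 : c < 1 by rewrite /c ltrBlDr ltrDl invr_gt0 mulr_gt0.
have [d /= d0 Hd] := cvgr_gt _ H _ c1.
have [k kd] : exists k : nat, 3 * k.+1%:R^-1 < d by exact: mul_invS_lt.
exists k => s sk.
have [->|s0] := eqVneq s 0.
  by exists 0; rewrite ?subrr ?normr0 ?mul0r// addr0.
have s0' : 0 < `|s| by rewrite normr_gt0.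
have [//|no] := pselect (exists2 s', `|s' - s| <= `|s| / l.+1%:R & A (a + s')).
exfalso.
have r0 : 0 < 3 * `|s| by rewrite mulr_gt0.
have := Hd (3 * `|s|).
rewrite /= sub0r normrN gtr0_norm// => /(_ _ r0).
have rd : 3 * `|s| < d by rewrite (le_lt_trans _ kd)// ler_pM2l// ltW.
move=> /(_ rd).
pose I := ball (a + s) (`|s| / l.+1%:R).
have sl : `|s| / l.+1%:R <= `|s|.
  by rewrite ler_pdivrMr// ler_peMr// ler1n.
have IB : I `<=` ball a (3 * `|s|).
  move=> z; rewrite /I /ball /= => Iz.
  rewrite -(subrK (a + s) a) -addrA (le_lt_trans (ler_normD _ _))//.
  rewrite opprD addNKr normrN.
  have := lt_le_trans Iz sl; lra.
have AI : (A `&` ball a (3 * `|s|)) `&` I = set0.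
  rewrite -subset0 => z [[Az _] Iz]; apply: no; exists (z - a).
    by move: Iz; rewrite /I /ball/= distrC opprD addrA => /ltW.
  by rewrite subrKC.
have mI : measurable I by exact: measurable_ball.
have mB : measurable (ball a (3 * `|s|)) by exact: measurable_ball.
have mAB : measurable (A `&` ball a (3 * `|s|)) by exact: measurableI.
have le1 : (mu (A `&` ball a (3 * `|s|)) + mu I <= mu (ball a (3 * `|s|)))%E.
  rewrite -measureU//.
  apply: le_measure; rewrite ?inE//; first exact: measurableU.
  by move=> z [[]|/IB].
have muI : mu I = (2 * (`|s| / l.+1%:R))%:E.
  by rewrite lebesgue_measure_ball ?divr_ge0// mulr_natl.
have muB : mu (ball a (3 * `|s|)) = (6 * `|s|)%:E.
  by rewrite lebesgue_measure_ball ?ltW//; congr EFin; lra.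
have finA : mu (A `&` ball a (3 * `|s|)) \is a fin_num.
  rewrite ge0_fin_numE//; apply: (@le_lt_trans _ _ (mu (ball a (3 * `|s|)))).
    by apply: le_measure; rewrite ?inE.
  by rewrite muB ltry.
rewrite -(fineK finA) muI muB -EFinD lee_fin in le1.
rewrite muB inver mulf_eq0 pnatr_eq0/= gt_eqF// -(fineK finA) -EFinM/=.
rewrite ltr_pdivlMr ?mulr_gt0//.
move: le1; set m := fine _; rewrite /c invfM.
have := invr_gt0 (l.+1%:R : R); rewrite ltr0Sn; set i := l.+1%:R^-1.
by clearbody i m; move=> i0; nra.
Qed.
End density.

(** * Null sets through sections *)

Section tuple_null.
Context {R : realType} {n : nat}.
Local Notation T := (measurableTypeR R).

Lemma lebesgue_tuple_null_xsection (A : set (n.+1.-tuple T)) : measurable A ->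
  (forall a, lebesgue_tuple n [set t | A (consT (a, t))] = 0%E) ->
  lebesgue_tuple n.+1 A = 0%E.
Proof.
move=> mA A0; rewrite /= /lebesgue_cons /pushforward /product_measure1.
apply: integral0_eq => a _ /=; rewrite xsectionE; exact: A0.
Qed.

(** The measure is defined by integrating over the first coordinate last; uniqueness of the product
    measure on rectangles permits the other order, where each section is a set of reals. *)
Lemma lebesgue_tuple_null_ysection (A : set (n.+1.-tuple T)) : measurable A ->
  (forall t, lebesgue_measure [set a | A (consT (a, t))] = 0%E) ->
  lebesgue_tuple n.+1 A = 0%E.
Proof.
move=> mA A0; rewrite /= /lebesgue_cons /pushforward.
have mB : measurable (@consT R n @^-1` A).
  by rewrite -[X in measurable X]setTI; exact: measurable_consT.
rewrite (@product_measure_unique _ _ _ _ _ _ _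
  (@lebesgue_measure R \x^ lebesgue_tuple n)%E) //; last first.
  by move=> B C mB' mC; rewrite /= product_measure2E.
rewrite /= /product_measure2.
apply: integral0_eq => t _ /=; rewrite ysectionE; exact: A0.
Qed.
End tuple_null.

Section row_cons.
Context {R : realType}.

Definition dot n (p h : 'rV[R]_n) : R := \sum_i p 0 i * h 0 i.

Lemma dotDr n (p h k : 'rV[R]_n) : dot p (h + k) = dot p h + dot p k.
Proof. by rewrite -big_split; apply: eq_bigr => i _; rewrite mxE mulrDr. Qed.

Lemma dotZr n (p h : 'rV[R]_n) a : dot p (a *: h) = a * dot p h.
Proof. by rewrite mulr_sumr; apply: eq_bigr => i _; rewrite mxE mulrCA. Qed.

Lemma dotBl n (p q h : 'rV[R]_n) : dot (p - q) h = dot p h - dot q h.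
Proof. by rewrite -sumrB; apply: eq_bigr => i _; rewrite !mxE mulrBl. Qed.

Lemma dot_le n (p h : 'rV[R]_n) (r : R) : (forall i, `|p 0 i| <= r) ->
  `|dot p h| <= n%:R * r * `|h|.
Proof.
move=> pr; rewrite /dot (le_trans (ler_norm_sum _ _ _))//.
rewrite (@le_trans _ _ (\sum_(i < n) r * `|h|))//.
  apply: ler_sum => i _; rewrite normrM ler_pM//.
  exact: row_coord_le.
by rewrite sumr_const card_ord mulr_natl mulrnAl.
Qed.

Definition row_cons n (a : R) (u : 'rV[R]_n) : 'rV[R]_n.+1 :=
  \row_i (if unlift ord0 i is Some j then u 0 j else a).

Lemma row_cons0 n a (u : 'rV[R]_n) : row_cons a u 0 ord0 = a.
Proof. by rewrite mxE unlift_none. Qed.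

Lemma row_consS n a (u : 'rV[R]_n) i : row_cons a u 0 (lift ord0 i) = u 0 i.
Proof. by rewrite mxE liftK. Qed.

Lemma row_of_tuple_cons n a (t : n.-tuple (measurableTypeR R)) :
  row_of_tuple (consT (a, t)) = row_cons a (row_of_tuple t).
Proof.
apply/rowP => i; case: (unliftP ord0 i) => [j|] ->.
  by rewrite row_consS !mxE tnthS.
by rewrite row_cons0 !mxE.
Qed.

Lemma row_consK n (v : 'rV[R]_n.+1) : v = row_cons (v 0 ord0) (\row_i v 0 (lift ord0 i)).
Proof.
apply/rowP => i; case: (unliftP ord0 i) => [j|] ->.
  by rewrite row_consS !mxE.
by rewrite row_cons0.
Qed.

Lemma row_consD n a b (u v : 'rV[R]_n) :
  row_cons a u + row_cons b v = row_cons (a + b) (u + v).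
Proof. by apply/rowP => i; rewrite !mxE; case: unlift => // j; rewrite mxE. Qed.

Lemma row_consB n a b (u v : 'rV[R]_n) :
  row_cons a u - row_cons b v = row_cons (a - b) (u - v).
Proof. by apply/rowP => i; rewrite !mxE; case: unlift => // j; rewrite !mxE. Qed.

Lemma row_cons_norm n a (u : 'rV[R]_n) : `|row_cons a u| = Num.max `|a| `|u|.
Proof.
apply/eqP; rewrite eq_le; apply/andP; split.
  rewrite ler_row_norm ?le_max ?normr_ge0//.
  apply/forallP => i; case: (unliftP ord0 i) => [j|] ->.
    by rewrite row_consS le_max row_coord_le orbT.
  by rewrite row_cons0 le_max lexx.
rewrite ge_max -{1}(row_cons0 a u) row_coord_le/= ler_row_norm//.
by apply/forallP => i; rewrite -(row_consS a u) row_coord_le.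
Qed.

Lemma dot_row_cons n a b (u v : 'rV[R]_n) :
  dot (row_cons a u) (row_cons b v) = a * b + dot u v.
Proof.
rewrite /dot big_ord_recl !row_cons0; congr (_ + _).
by apply: eq_bigr => i _; rewrite !row_consS.
Qed.
End row_cons.

(** * First-order expansions with rational slopes *)

Section approx_diff.
Context {R : realType}.

(* [J] selects the coordinates that vary. In [wdiff] the slopes are rational and
   depend on the precision, so that the set of such points is a countable
   combination of closed sets, hence measurable. *)
Definition apx j n (f : 'rV[R]_n -> R) (J : 'rV[R]_j -> 'rV[R]_n)
    (p : 'rV[R]_j) (k l : nat) : set 'rV[R]_n :=
  [set x | forall h, `|h| < k.+1%:R^-1 ->
    `|f (x + J h) - f x - dot p h| <= `|h| / l.+1%:R].

Definition wdiff j n (f : 'rV[R]_n -> R) (J : 'rV[R]_j -> 'rV[R]_n) x :=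
  forall l, exists (p : 'rV[rat]_j) (k : nat), apx f J (map_mx ratr p) k l x.

Lemma closed_apx j n (f : 'rV[R]_n -> R) (J : 'rV[R]_j -> 'rV[R]_n) p k l :
  continuous f -> closed (apx f J p k l).
Proof.
move=> cf.
rewrite (_ : apx f J p k l = \bigcap_(h in [set h : 'rV[R]_j | `|h| < k.+1%:R^-1])
   (fun x => `|f (x + J h) - f x - dot p h|) @^-1` [set r | r <= `|h| / l.+1%:R]);
   last by [].
apply: closed_bigI => h _.
apply: preimage_closed; last exact: closed_le.
have cg : continuous (fun x : 'rV[R]_n => f (x + J h) - f x - dot p h : R^o).
  move=> x.
  have c1 : {for (x : 'rV[R]_n), continuous (fun z : 'rV[R]_n => z + J h)}.
    exact: (cvgD cvg_id (cvg_cst _)).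
  have c2 : {for (x : 'rV[R]_n), continuous (fun z : 'rV[R]_n => f (z + J h))}.
    exact: (continuous_comp c1 (cf _)).
  exact: (cvgB (cvgB c2 (cf x)) (cvg_cst _)).
by move=> x _; exact: (cvg_norm (cg x)).
Qed.

Lemma measurable_wdiff j n (f : 'rV[R]_n -> R) (J : 'rV[R]_j -> 'rV[R]_n) :
  continuous f ->
  measurable [set t : n.-tuple (measurableTypeR R) | wdiff f J (row_of_tuple t)].
Proof.
move=> cf.
rewrite (_ : mkset _ = \bigcap_(l : nat) \bigcup_(pk : 'rV[rat]_j * nat)
  [set t : n.-tuple (measurableTypeR R) | apx f J (map_mx ratr pk.1) pk.2 l (row_of_tuple t)]).
  apply: bigcapT_measurable => l.
  apply: countable_bigcupT_measurable => // pk.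
  apply: measurable_row_closed; exact: closed_apx.
apply/seteqP; split => t /=.
  by move=> H l _; have [p [k Hpk]] := H l; exists (p, k).
by move=> H l; have [[p k] _ Hpk] := H l Logic.I; exists p, k.
Qed.
End approx_diff.

Section density_step.
Context {R : realType} {n : nat}.
Local Notation T := (measurableTypeR R).

(* Only rational [s] are tested, for measurability. *)
Definition dense_hits (A : set 'rV[R]_n.+1) (l : nat) : set 'rV[R]_n.+1 :=
  [set v | exists k : nat, forall s : rat, `|ratr s : R| < k.+1%:R^-1 ->
    exists2 s', `|s' - ratr s| <= `|ratr s| / l.+1%:R & A (v + row_cons s' 0)].

(** The existential over the reals would be a projection; compactness of the segment keeps it
    closed. Around a row [v] outside the set, finitely many neighbourhoods of points of the segment
    give one neighbourhood of [v] that works for all [s]. *)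
Lemma closed_segment_hits (A : set 'rV[R]_n.+1) (a b : R) : closed A ->
  closed [set v | exists2 s, `[a, b]%classic s & A (v + row_cons s 0)].
Proof.
move=> cA; rewrite -[X in closed X]setCK; apply: open_closedC.
rewrite openE => v /= nv.
have : \forall v' \near v, `[a, b]%classic `<=` (fun s => (~` A) (v' + row_cons s 0)).
  have /compact_near_coveringP/(_ 'rV[R]_n.+1 (nbhs (v : 'rV[R]_n.+1))
    (fun v' s => (~` A) (v' + row_cons s 0))) := @segment_compact R a b.
  apply=> s abs.
  have oA : nbhs (v + row_cons s 0) (~` A).
    apply: open_nbhs_nbhs; split; first exact: closed_openC.
    by move=> As; apply: nv; exists s.
  have /nbhs_ballP[e /= e0 He] := oA.
  near=> s' v' => /=; apply: He.
  have s's : `|s - s'| < e / 2 by near: s'; apply: cvgr_dist_lt => //; exact: divr_gt0.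
  have v'v : `|v - v'| < e / 2 by near: v'; apply: cvgr_dist_lt => //; exact: divr_gt0.
  rewrite -ball_normE /=.
  rewrite opprD addrACA row_consB subr0 (le_lt_trans (ler_normD _ _))//.
  rewrite row_cons_norm normr0 max_l// [ltRHS]splitr; exact: ltrD.
apply: filterS => v' Hv' [s abs As]; exact: (Hv' s abs).
Unshelve. all: by end_near. Qed.

Lemma measurable_dense_hits (A : set 'rV[R]_n.+1) l : closed A ->
  measurable [set t : n.+1.-tuple T | dense_hits A l (row_of_tuple t)].
Proof.
move=> cA.
rewrite (_ : mkset _ = \bigcup_(k : nat) \bigcap_(s in [set s : rat | `|ratr s : R| < k.+1%:R^-1])
  [set t : n.+1.-tuple T | [set v | exists2 s',
      `[ratr s - `|ratr s| / l.+1%:R, ratr s + `|ratr s| / l.+1%:R]%classic s'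
     & A (v + row_cons s' 0)] (row_of_tuple t)]).
  apply: bigcupT_measurable => k.
  rewrite -[X in measurable X]setCK; apply: measurableC.
  rewrite setC_bigcap bigcup_mkcond.
  apply: countable_bigcupT_measurable => // s.
  case: ifP => _; last exact: measurable0.
  apply: measurableC; apply: measurable_row_closed; exact: closed_segment_hits.
apply/seteqP; split => t /=.
  move=> [k Hk]; exists k => // s /= sk; have [s' s's As'] := Hk s sk.
  by exists s' => //; rewrite in_itv/= -ler_distl.
move=> [k _ Hk]; exists k => s sk; have [s' s's As'] := Hk s sk.
by exists s' => //; rewrite ler_distl; move: s's; rewrite in_itv.
Qed.

(** The exceptional set is measurable, so it suffices that its trace on each line parallel to the
    first axis is null. There it lies in the exceptional set of the one-dimensional density
    statement. *)
Lemma ae_dense_hits (A : set 'rV[R]_n.+1) l : closed A ->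
  {ae lebesgue_tuple n.+1, forall t,
    A (row_of_tuple t) -> dense_hits A l (row_of_tuple t)}.
Proof.
move=> cA.
pose B := [set t : n.+1.-tuple T | A (row_of_tuple t)] `\`
  [set t | dense_hits A l (row_of_tuple t)].
have mB : measurable B.
  by apply: measurableD; [exact: measurable_row_closed|exact: measurable_dense_hits].
exists B; split => //; last by move=> t /= /not_implyP.
apply: lebesgue_tuple_null_ysection => // t.
pose u := row_of_tuple t.
pose S := [set a : R | A (row_cons a u)].
have cS : closed S.
  apply: preimage_closed => // a _.
  apply/cvgrPdist_lt => e e0; apply/nbhs_ballP; exists e => //= b.
  by rewrite /ball/= row_consB subrr row_cons_norm normr0 max_l.
have mS : measurable S by exact: closed_measurable.
have [Z [mZ Z0 HZ]] := ae_density_hits l mS.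
have mBt : measurable [set a | B (consT (a, t))].
  have mC : measurable (@consT R n @^-1` B).
    by rewrite -[X in measurable X]setTI; exact: measurable_consT.
  have := measurable_ysection t mC.
  by rewrite ysectionE.
apply: subset_measure0 Z0 => //.
move=> a; rewrite /B /= !row_of_tuple_cons => -[Aa nd]; apply: HZ => /= H.
apply: nd; have [k Hk] := H Aa; exists k => s sk; have [s' s's As'] := Hk _ sk.
by exists s' => //; rewrite row_consD addr0.
Qed.
End density_step.

Section rademacher_step.
Context {R : realType} {n : nat}.
Variables (f : 'rV[R]_n.+1 -> R) (L : R).
Hypothesis fL : forall x y, `|f x - f y| <= L * `|x - y|.

Let J0 (s : 'rV[R]_1) : 'rV[R]_n.+1 := row_cons (s 0 0) 0.
Let J1 (u : 'rV[R]_n) : 'rV[R]_n.+1 := row_cons 0 u.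

(** The slopes in [wdiff] change with the precision, so they need a bound that does not. Testing the
    expansion at a single increment gives one: the relative error [1/(l+1)] is at most 1. *)
Lemma apx_slope_le q k l (x : 'rV[R]_n.+1) : apx f J0 q k l x -> `|q 0 0| <= L + 1.
Proof.
move=> H; pose c : R := k.+1%:R^-1 / 2.
have c0 : 0 < c by rewrite divr_gt0.
have cn : `|(const_mx c : 'rV[R]_1)| = c.
  apply/eqP; rewrite eq_le ler_row_norm ?(ltW c0)//; apply/andP; split.
    by apply/forallP => i; rewrite mxE gtr0_norm.
  by have := row_coord_le (const_mx c : 'rV[R]_1) 0; rewrite mxE gtr0_norm.
have := H (const_mx c); rewrite cn.
have ck : c < k.+1%:R^-1 by rewrite /c ltr_pdivrMr// ltr_pMr ?invr_gt0// ltr1n.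
move=> /(_ ck).
have := fL (x + J0 (const_mx c)) x.
rewrite addrAC subrr add0r /J0 mxE row_cons_norm normr0 max_l// (gtr0_norm c0).
rewrite /dot big_ord1 mxE => H1 H2.
have H3 : c / l.+1%:R <= c by rewrite ler_pdivrMr// ler_peMr ?(ltW c0)// ler1n.
have H4 : `|q 0 0 * c| <= L * c + c.
  rewrite -[q 0 0 * c](subKr (f (x + row_cons c 0) - f x)).
  apply: (le_trans (ler_normB _ _)); apply: lerD => //.
  exact: le_trans H2 H3.
by rewrite normrM (gtr0_norm c0) -[X in _ + X]mul1r -mulrDl ler_pM2r in H4.
Qed.

(* With [h = (s, h')], choose [s'] near [s] such that [z = v + (s', 0)] satisfies
   the same expansions as [v]; then use the one in [h'] at [z] and the one in
   [s'] at [v]. *)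
Lemma wdiff_step (v : 'rV[R]_n.+1) :
  wdiff f J0 v -> wdiff f J1 v ->
  (forall (q : 'rV[rat]_1) k1 (p : 'rV[rat]_n) k2 l,
     (apx f J0 (map_mx ratr q) k1 l `&` apx f J1 (map_mx ratr p) k2 l) v ->
     dense_hits (apx f J0 (map_mx ratr q) k1 l `&` apx f J1 (map_mx ratr p) k2 l) l v) ->
  wdiff f id v.
Proof.
move=> H0 H1 HD l.
have L0 : 0 <= L + 1.
  have [q [k /apx_slope_le]] := H0 0%N; exact: le_trans.
have [L0'|L0'] := ltP L 0.
  exfalso; have := fL (const_mx 1) 0; rewrite subr0.
  apply/negP; rewrite -ltNge (@lt_le_trans _ _ 0)// nmulr_rlt0// normr_gt0.
  by apply/eqP => /rowP/(_ 0); rewrite !mxE => /eqP; rewrite oner_eq0.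
(* The four errors below, in units of [e * |h|], are [3L], 1, 4 and [3(L+1)]; they add up to
   [6L + 8], and the rest is slack. *)
have C0 : 0 < 6 * L + 12 :> R by lra.
have [l' Hl'] : exists l' : nat, (6 * L + 12) * l'.+1%:R^-1 < l.+1%:R^-1.
  by apply: mul_invS_lt => //; rewrite invr_gt0.
have [q [k1 Hq]] := H0 l'.
have [p [k2 Hp]] := H1 l'.
have [k3 Hk3] := HD _ _ _ _ _ (conj Hq Hp).
have qL := apx_slope_le Hq; rewrite mxE in qL.
set e : R := l'.+1%:R^-1 in Hl' *.
have e0 : 0 < e by rewrite invr_gt0.
have e1 : e <= 1 by rewrite invf_le1// ler1n.
pose m := maxn k1 (maxn k2 k3).
have mle k : (k <= m)%N -> m.+1%:R^-1 <= k.+1%:R^-1 :> R.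
  by move=> km; rewrite lef_pV2 ?posrE// ler_nat ltnS.
(* The displacement [s'] used in place of [s] can be as large as [4|h|], and the expansion at [v]
   must still apply to it. *)
have [K HK] : exists K : nat, 4 * K.+1%:R^-1 < m.+1%:R^-1 :> R.
  by apply: mul_invS_lt => //; rewrite invr_gt0.
pose P : 'rV[rat]_n.+1 := \row_i (if unlift ord0 i is Some j then p 0 j else q 0 0).
have PE : map_mx ratr P = row_cons (ratr (q 0 0)) (map_mx ratr p) :> 'rV[R]_n.+1.
  by apply/rowP => i; rewrite !mxE; case: unlift => // j; rewrite mxE.
exists P, K => h hK; rewrite PE.
have [->|hn0] := eqVneq h 0.
  by rewrite addr0 subrr sub0r normrN -(scale0r 0) dotZr mul0r scale0r !normr0 mul0r.
have h0 : 0 < `|h| by rewrite normr_gt0.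
have h4m : 4 * `|h| < m.+1%:R^-1 by apply: lt_trans HK; rewrite ltr_pM2l.
have h2m : 2 * `|h| < m.+1%:R^-1.
  by apply: le_lt_trans h4m; rewrite ler_pM2r// ler_nat.
have h1m : `|h| < m.+1%:R^-1.
  by apply: le_lt_trans h4m; rewrite ler_peMl// ler1n.
have := row_consK h; set s := h 0 ord0; set h' := \row_i _ => hE.
have sh : `|s| <= `|h| by exact: row_coord_le.
have h'h : `|h'| <= `|h| by rewrite [X in _ <= `|X|]hE row_cons_norm le_max lexx orbT.
(* [dense_hits] answers only for rational displacements, so [s] is first replaced by a rational
   within [e * |h|], which costs no more than the precision sought. *)
have /rat_in_itvoo[r] : s < s + e * `|h| by rewrite ltrDl mulr_gt0.
rewrite in_itv/= => /andP[sr rs].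
have ehh : e * `|h| <= `|h| by rewrite ler_piMl.
have rh : `|ratr r : R| <= 2 * `|h|.
  by move: sh; rewrite !ler_norml => /andP[? ?]; apply/andP; split; lra.
have [|s' s'r [A0 A1]] := Hk3 r.
  apply: (le_lt_trans rh); apply: (lt_le_trans h2m).
  by apply: mle; rewrite !leq_max leqnn !orbT.
have s'r' : `|s' - ratr r| <= 2 * (e * `|h|).
  by rewrite (le_trans s'r)// mulrC mulrCA ler_pM2l.
have s's : `|s' - s| <= 3 * (e * `|h|).
  by move: s'r'; rewrite !ler_norml => /andP[? ?]; apply/andP; split; lra.
have s'h : `|s'| <= 4 * `|h|.
  move: s'r' rh; rewrite !ler_norml => /andP[? ?] /andP[? ?].
  by apply/andP; split; lra.
pose z := v + row_cons s' 0.
have E1 : `|f (v + h) - f (z + J1 h')| <= L * (3 * (e * `|h|)).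
  apply: le_trans (fL _ _) _; rewrite ler_wpM2l//.
  have -> : v + h - (z + J1 h') = row_cons (s - s') 0.
    rewrite [in LHS]hE /z /J1 -(addrA v (row_cons s' 0)) row_consD addr0 add0r.
    by rewrite opprD addrACA subrr add0r row_consB subrr.
  by rewrite row_cons_norm normr0 max_l// distrC.
have E2 : `|f (z + J1 h') - f z - dot (map_mx ratr p) h'| <= e * `|h|.
  apply: (le_trans (A1 h' _)); last by rewrite mulrC ler_pM2l.
  apply: (le_lt_trans h'h); apply: (lt_le_trans h1m).
  by apply: mle; rewrite !leq_max leqnn !orbT.
pose s'1 : 'rV[R]_1 := const_mx s'.
have s'1n : `|s'1| = `|s'|.
  apply/eqP; rewrite eq_le ler_row_norm//; apply/andP; split.
    by apply/forallP => i; rewrite mxE.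
  by have := row_coord_le s'1 0; rewrite mxE.
have E3 : `|f z - f v - ratr (q 0 0) * s'| <= 4 * (e * `|h|).
  have := Hq s'1; rewrite s'1n /J0 /dot big_ord1 !mxE -/z => E.
  apply: (le_trans (E _)).
    apply: (le_lt_trans s'h); apply: (lt_le_trans h4m).
    by apply: mle; rewrite !leq_max leqnn.
  by rewrite mulrC mulrCA ler_pM2l.
have E4 : `|ratr (q 0 0) * (s' - s)| <= (L + 1) * (3 * (e * `|h|)).
  by rewrite normrM ler_pM.
have -> : f (v + h) - f v - dot (row_cons (ratr (q 0 0)) (map_mx ratr p)) h =
  (f (v + h) - f (z + J1 h')) + (f (z + J1 h') - f z - dot (map_mx ratr p) h')
  + (f z - f v - ratr (q 0 0) * s') + ratr (q 0 0) * (s' - s).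
  by rewrite [in LHS]hE dot_row_cons -hE; ring.
have E12 := le_trans (ler_normD _ _) (lerD E1 E2).
have E123 := le_trans (ler_normD _ _) (lerD E12 E3).
apply: (le_trans (le_trans (ler_normD _ _) (lerD E123 E4)) _).
apply: (@le_trans _ _ ((6 * L + 12) * e * `|h|)); last first.
  by rewrite [leRHS]mulrC ler_wpM2r// ltW.
rewrite -subr_ge0 (_ : _ - _ = 4 * (e * `|h|)); last by ring.
by rewrite !mulr_ge0// ltW.
Qed.
End rademacher_step.

Lemma lipschitz_norm_continuous (R : realType) (V W : normedModType R)
    (f : V -> W) (L : R) :
  (forall x y, `|f x - f y| <= L * `|x - y|) -> continuous f.
Proof.
move=> fL x; apply/cvgrPdist_lt => e e0; apply/nbhs_ballP.
have L1 : 0 < `|L| + 1 by rewrite ltr_wpDl.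
exists (e / (`|L| + 1)) => /=; first exact: divr_gt0.
move=> y; rewrite -ball_normE /= ltr_pdivlMr// => xy.
apply: le_lt_trans xy; apply: le_trans (fL _ _) _.
by rewrite mulrC ler_wpM2l// (le_trans (ler_norm _))// lerDl.
Qed.

Section rademacher.
Context {R : realType}.
Local Notation T := (measurableTypeR R).

Lemma derivable_rat_approx (F : R -> R) a (l : nat) : derivable F a 1 ->
  exists (q : rat) (k : nat), forall s, `|s| < k.+1%:R^-1 ->
    `|F (a + s) - F a - ratr q * s| <= `|s| / l.+1%:R.
Proof.
move=> dF; pose e : R := l.+1%:R^-1 / 2.
have e0 : 0 < e by rewrite divr_gt0.
have /cvgrPdist_le/(_ _ e0) := dF; set D := lim _.
move=> [d /= d0 Hd].
have [q] : exists q : rat, ratr q \in `]D, D + e[.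
  by apply: rat_in_itvoo; rewrite ltrDl.
rewrite in_itv/= => /andP[q1 q2].
have [k] : exists k : nat, 1 * k.+1%:R^-1 < d by exact: mul_invS_lt.
rewrite mul1r => kd; exists q, k => s sk.
have [->|s0] := eqVneq s 0.
  by rewrite addr0 subrr mulr0 subr0 normr0 mul0r.
have := Hd s; rewrite /ball_/= sub0r normrN => /(_ (lt_trans sk kd) s0).
rewrite /GRing.scale/= mulr1 (addrC s) => H.
have -> : F (a + s) - F a - ratr q * s =
   (- (D - s^-1 * (F (a + s) - F a)) + (D - ratr q)) * s.
  by field.
rewrite normrM mulrC ler_wpM2l// (le_trans (ler_normD _ _))//.
rewrite normrN [leRHS]splitr lerD// ler0_norm; last by lra.
by rewrite -/e; lra.
Qed.

Lemma ae_countable d (S : measurableType d) (mu : {measure set S -> \bar R})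
    (I : countType) (P : I -> S -> Prop) :
  (forall i, {ae mu, forall x, P i x}) -> {ae mu, forall x, forall i, P i x}.
Proof.
move=> H.
have H' k : {ae mu, forall x, if unpickle k is Some i then P i x else True}.
  by case: unpickle => [i|]; [exact: H|exact: aeW].
have := ae_foralln H'; apply: filterS => x Hx i.
by have := Hx (pickle i); rewrite pickleK.
Qed.

(** The induction carries [wdiff] and not differentiability because testing nullity on sections
    requires a measurable exceptional set. *)
Lemma ae_wdiff n (f : 'rV[R]_n -> R) (L : R) :
  (forall x y, `|f x - f y| <= L * `|x - y|) ->
  {ae lebesgue_tuple n, forall t, wdiff f id (row_of_tuple t)}.
Proof.
elim: n f => [|n IHn] f fL.
  apply: aeW => t l; exists 0, 0%N => h _.
  have -> : row_of_tuple t + h = row_of_tuple t by apply/rowP => -[].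
  by rewrite subrr /dot big_ord0 subrr normr0 divr_ge0.
have cf : continuous f.
  exact: (lipschitz_norm_continuous fL).
pose J0 (s : 'rV[R]_1) : 'rV[R]_n.+1 := row_cons (s 0 0) 0.
pose J1 (u : 'rV[R]_n) : 'rV[R]_n.+1 := row_cons 0 u.
have ae0 : {ae lebesgue_tuple n.+1, forall t, wdiff f J0 (row_of_tuple t)}.
  exists (~` [set t | wdiff f J0 (row_of_tuple t)]); split => //.
    by apply: measurableC; exact: measurable_wdiff.
  apply: lebesgue_tuple_null_ysection.
    by apply: measurableC; exact: measurable_wdiff.
  move=> t; pose u := row_of_tuple t.
  have FL x y : `|f (row_cons x u) - f (row_cons y u)| <= L * `|x - y|.
    apply: le_trans (fL _ _) _.
    by rewrite row_consB subrr row_cons_norm normr0 max_l.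
  have [Z [mZ Z0 HZ]] := lipschitz_ae_derivable FL.
  apply: subset_measure0 Z0 => //.
    have mC : measurable (@consT R n @^-1` ~` [set t | wdiff f J0 (row_of_tuple t)]).
      rewrite -[X in measurable X]setTI; apply: measurable_consT => //.
      by apply: measurableC; exact: measurable_wdiff.
    by have := measurable_ysection t mC; rewrite ysectionE.
  move=> a /=; rewrite row_of_tuple_cons => nH; apply: HZ => /= dF; apply: nH => l.
  have [q [k H]] := derivable_rat_approx l dF.
  exists (const_mx q), k => h hk.
  rewrite /J0 row_consD addr0 /dot big_ord1 !mxE.
  apply: le_trans (H _ _) _.
    exact: le_lt_trans (row_coord_le _ _) hk.
  by rewrite ler_wpM2r// row_coord_le.
have ae1 : {ae lebesgue_tuple n.+1, forall t, wdiff f J1 (row_of_tuple t)}.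
  exists (~` [set t | wdiff f J1 (row_of_tuple t)]); split => //.
    by apply: measurableC; exact: measurable_wdiff.
  apply: lebesgue_tuple_null_xsection.
    by apply: measurableC; exact: measurable_wdiff.
  move=> a.
  have FL x y : `|f (row_cons a x) - f (row_cons a y)| <= L * `|x - y|.
    apply: le_trans (fL _ _) _.
    by rewrite row_consB subrr row_cons_norm normr0 max_r.
  have [Z [mZ Z0 HZ]] := IHn _ FL.
  apply: subset_measure0 Z0 => //.
    have mC : measurable (@consT R n @^-1` ~` [set t | wdiff f J1 (row_of_tuple t)]).
      rewrite -[X in measurable X]setTI; apply: measurable_consT => //.
      by apply: measurableC; exact: measurable_wdiff.
    by have := measurable_xsection a mC; rewrite xsectionE.
  move=> t /=; rewrite row_of_tuple_cons => nH; apply: HZ => /= dF; apply: nH => l.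
  have [p [k H]] := dF l; exists p, k => h hk.
  by rewrite /J1 row_consD addr0; exact: H.
(* Rational slopes and integer precisions leave countably many sets [A i], so one null set serves
   all the density statements. *)
pose I : countType := ('rV[rat]_1 * nat * ('rV[rat]_n * nat) * nat)%type.
pose A (i : I) := apx f J0 (map_mx ratr i.1.1.1) i.1.1.2 i.2
  `&` apx f J1 (map_mx ratr i.1.2.1) i.1.2.2 i.2.
have aeD : {ae lebesgue_tuple n.+1, forall t, forall i : I,
    A i (row_of_tuple t) -> dense_hits (A i) i.2 (row_of_tuple t)}.
  apply: ae_countable => i; apply: ae_dense_hits.
  by apply: closedI; exact: closed_apx.
apply: filterS3 ae0 ae1 aeD => t H0 H1 HD.
apply: (wdiff_step fL) => // q k1 p k2 l Hv.
exact: (HD (q, k1, (p, k2), l)).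
Qed.
End rademacher.

(** * Gradients and Jacobians *)

Section differential.
Context {R : realType}.

Lemma is_diff_near (V W : normedModType R) (f : V -> W) (x : V)
    (A : {linear V -> W}) : continuous A ->
  (forall e, 0 < e -> \forall h \near (0 : V),
     `|f (x + h) - f x - A h| <= e * `|h|) ->
  is_diff x f A.
Proof.
move=> cA H.
have E : f \o shift x = cst (f x) + A +o_ (0 : V) id.
  apply/eqaddoP => e e0; apply: filterS (H e e0) => h.
  by rewrite /= !fctE /= opprD addrA (addrC h).
have dE := diff_unique cA E.
by split => //; apply/diff_locallyP; rewrite dE.
Qed.

Lemma dot_is_linear n (p : 'rV[R]_n) : linear (dot p : 'rV[R]_n -> R^o).
Proof. by move=> a u v; rewrite dotDr dotZr. Qed.

HB.instance Definition _ n (p : 'rV[R]_n) :=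
  GRing.isLinear.Build R 'rV[R]_n R^o _ (dot p) (dot_is_linear p).

Lemma dot_lipschitz n (p : 'rV[R]_n) (x y : 'rV[R]_n) :
  `|dot p x - dot p y| <= n%:R * `|p| * `|x - y|.
Proof.
have -> : dot p x - dot p y = dot p (x - y).
  by rewrite dotDr -(scaleN1r y) dotZr mulN1r.
by apply: dot_le => i; exact: row_coord_le.
Qed.

Lemma dot_continuous n (p : 'rV[R]_n) : continuous (dot p : 'rV[R]_n -> R).
Proof. exact: (lipschitz_norm_continuous (@dot_lipschitz n p)). Qed.

Lemma dot_delta n (p : 'rV[R]_n) j : dot p (delta_mx 0 j) = p 0 j.
Proof.
rewrite /dot (bigD1 j)//= mxE !eqxx mulr1 big1 ?addr0// => i ij.
by rewrite mxE (negbTE ij) andbF mulr0.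
Qed.

Lemma diff_grad n (f : 'rV[R]_n -> R) (x h : 'rV[R]_n) :
  differentiable f x -> 'd f x h = dot (grad f x) h.
Proof.
move=> df; rewrite [in LHS](row_sum_delta h) linear_sum; apply: eq_bigr => j _.
by rewrite linearZ /= !mxE deriveE// mulrC.
Qed.

Lemma near_diff_grad n (f : 'rV[R]_n -> R) (x : 'rV[R]_n) (e : R) :
  differentiable f x -> 0 < e -> \forall h \near (0 : 'rV[R]_n),
    `|f (x + h) - f x - dot (grad f x) h| <= e * `|h|.
Proof.
move=> df e0; have /diff_locally/eqaddoP/(_ e e0) := df.
apply: filterS => h; rewrite /= !fctE /= opprD addrA (addrC h).
by rewrite diff_grad.
Qed.

Lemma grad_is_diff n (f : 'rV[R]_n -> R) (x p : 'rV[R]_n) :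
  is_diff x f (dot p) -> grad f x = p.
Proof.
move=> [df dE]; apply/rowP => j; rewrite mxE deriveE// dE; exact: dot_delta.
Qed.

Lemma is_diff_dot n (f : 'rV[R]_n -> R) (x p : 'rV[R]_n) :
  (forall e, 0 < e -> \forall h \near (0 : 'rV[R]_n),
     `|f (x + h) - f x - dot p h| <= e * `|h|) ->
  is_diff x f (dot p).
Proof. by move=> H; apply: (is_diff_near (A := dot p)) => //; exact: dot_continuous. Qed.

(** Two slopes belonging to precisions [l] and [l'] both describe [f] on a common small increment
    along an axis, so they differ by at most [e l + e l']. They therefore converge, and the limit is
    the gradient. *)
Lemma wdiff_differentiable n (f : 'rV[R]_n -> R) (x : 'rV[R]_n) :
  wdiff f id x -> differentiable f x.
Proof.
move=> H; have [p Hp] := choice H.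
pose e (l : nat) : R := l.+1%:R^-1.
have e0 l : 0 < e l by rewrite invr_gt0.
pose q l : 'rV[R]_n := map_mx ratr (p l).
have Hq l : exists k, apx f id (q l) k l x by exact: Hp.
have qq l l' i : q l 0 i <= q l' 0 i + e l + e l'.
  have [k Hk] := Hq l; have [k' Hk'] := Hq l'.
  pose m := maxn k k'; pose c : R := m.+1%:R^-1 / 2.
  have c0 : 0 < c by rewrite divr_gt0.
  have cm j : (j <= m)%N -> c < j.+1%:R^-1.
    move=> jm; apply: (@lt_le_trans _ _ m.+1%:R^-1).
      by rewrite /c ltr_pdivrMr// ltr_pMr ?invr_gt0// ltr1n.
    by rewrite lef_pV2 ?posrE// ler_nat ltnS.
  pose h : 'rV[R]_n := c *: delta_mx 0 i.
  have hn : `|h| <= c.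
    rewrite ler_row_norm ?(ltW c0)//; apply/forallP => j; rewrite !mxE eqxx/=.
    by case: (j == i); rewrite ?mulr1 ?mulr0 ?normr0 ?(ltW c0)// gtr0_norm.
  have h1 : `|f (x + h) - f x - c * q l 0 i| <= c * e l.
    have := Hk h (le_lt_trans hn (cm _ (leq_maxl _ _))).
    rewrite /h dotZr dot_delta => /le_trans; apply.
    by rewrite ler_wpM2r// ltW.
  have h2 : `|f (x + h) - f x - c * q l' 0 i| <= c * e l'.
    have := Hk' h (le_lt_trans hn (cm _ (leq_maxr _ _))).
    rewrite /h dotZr dot_delta => /le_trans; apply.
    by rewrite ler_wpM2r// ltW.
  have : c * q l 0 i <= c * q l' 0 i + c * e l + c * e l'.
    by move: h1 h2; rewrite !ler_norml => /andP[? ?] /andP[? ?]; lra.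
  by rewrite -!mulrDr ler_pM2l.
(* By [qq], every [q l - e l] is below every [q l' + e l']; the supremum lies in all the intervals
   of radius [e l] around [q l], which gives the limit together with its rate. *)
pose P : 'rV[R]_n := \row_i sup (range (fun l => q l 0 i - e l)).
have supP i : has_sup (range (fun l => q l 0 i - e l)).
  split; first by exists (q 0%N 0 i - e 0%N), 0%N.
  exists (q 0%N 0 i + e 0%N) => _ [l _ <-].
  by rewrite lerBlDr; have := qq l 0%N i; lra.
have Pq l i : `|q l 0 i - P 0 i| <= e l.
  have -> : P 0 i = sup (range (fun l => q l 0 i - e l)) by rewrite mxE.
  set s := sup _.
  have s1 : q l 0 i - e l <= s.
    by apply: sup_upper_bound => //; exists l.
  have s2 : s <= q l 0 i + e l.
    apply: ge_sup; first by case: (supP i).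
    by move=> _ [l' _ <-]; have := qq l' l i; lra.
  by rewrite ler_norml; apply/andP; split; lra.
have : is_diff x f (dot P); last by case.
apply: is_diff_dot => d d0.
(* One unit pays for the expansion with slope [q l], and [n] units for replacing [q l] by [P] in
   each coordinate. *)
have [l Hl] : exists l : nat, (1 + n%:R) * l.+1%:R^-1 < d.
  by apply: mul_invS_lt => //; rewrite ltr_wpDr.
have [k Hk] := Hq l.
apply/nbhs_ballP; exists k.+1%:R^-1 => /=; first by rewrite invr_gt0.
move=> h; rewrite -ball_normE /= sub0r normrN => hk.
have := Hk h hk.
have := dot_le (p := q l - P) h (r := e l).
have H1 : forall i, `|(q l - P) 0 i| <= e l.
  by move=> i; have := Pq l i; rewrite !mxE.
move=> /(_ H1); rewrite dotBl => h1 h2.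
have -> : f (x + h) - f x - dot P h =
  (f (x + h) - f x - dot (q l) h) + (dot (q l) h - dot P h) by ring.
apply: (le_trans (ler_normD _ _)); apply: (le_trans (lerD h2 h1)).
apply: (@le_trans _ _ ((1 + n%:R) * l.+1%:R^-1 * `|h|)).
  by rewrite /e le_eqVlt; apply/orP; left; apply/eqP; ring.
by rewrite ler_wpM2r// ltW.
Qed.

Lemma grad_lipschitz n (f : 'rV[R]_n -> R) (L : R) x j :
  (forall u v, `|f u - f v| <= L * `|u - v|) ->
  differentiable f x -> `|grad f x 0 j| <= L.
Proof.
move=> fL df; apply/ler_addgt0Pr => e e0.
have /nbhs_ballP[d /= d0 Hd] := near_diff_grad df e0.
have d2 : 0 < d / 2 by rewrite divr_gt0.
pose h : 'rV[R]_n := (d / 2) *: delta_mx 0 j.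
have hn : `|h| <= d / 2.
  rewrite ler_row_norm ?(ltW d2)//; apply/forallP => i; rewrite !mxE eqxx/=.
  by case: (i == j); rewrite ?mulr1 ?mulr0 ?normr0 ?(ltW d2)// gtr0_norm.
have := Hd h; rewrite -ball_normE /= sub0r normrN.
have dd : d / 2 < d by rewrite ltr_pdivrMr// ltr_pMr// ltr1n.
move=> /(_ (le_lt_trans hn dd)); rewrite {2}/h dotZr dot_delta => H.
have H1 : `|f (x + h) - f x| <= L * `|h|.
  by have := fL (x + h) x; rewrite addrAC subrr add0r.
have h0 : 0 < `|h|.
  by have := row_coord_le h j; rewrite !mxE !eqxx mulr1 gtr0_norm//; exact: lt_le_trans.
have L0 : 0 <= L by rewrite -(pmulr_lge0 _ h0) (le_trans _ H1).
have : `|d / 2 * grad f x 0 j| <= (L + e) * (d / 2).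
  rewrite -[d / 2 * _](subKr (f (x + h) - f x)).
  apply: (le_trans (ler_normB _ _)); rewrite mulrDl lerD//.
    by apply: (le_trans H1); rewrite ler_wpM2l.
  by apply: (le_trans H); rewrite ler_wpM2l// ltW.
by rewrite normrM (gtr0_norm d2) mulrC ler_pM2r.
Qed.

(** A gradient as a limit of countably many difference quotients: the source of its measurability in
    the base point. *)
Lemma grad_cvg n (f : 'rV[R]_n -> R) x j : differentiable f x ->
  k.+1%:R * (f (x + k.+1%:R^-1 *: delta_mx 0 j) - f x) @[k --> \oo] --> grad f x 0 j.
Proof.
move=> df; apply/cvgrPdist_le => e e0.
have /nbhs_ballP[d /= d0 Hd] := near_diff_grad df e0.
near=> k.
have kd : k.+1%:R^-1 < d by near: k; exact: (near_infty_natSinv_lt (PosNum d0)).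
pose h : 'rV[R]_n := k.+1%:R^-1 *: delta_mx 0 j.
have k0 : 0 < k.+1%:R^-1 :> R by rewrite invr_gt0.
have hn : `|h| <= k.+1%:R^-1.
  rewrite ler_row_norm ?(ltW k0)//; apply/forallP => i; rewrite !mxE eqxx/=.
  by case: (i == j); rewrite ?mulr1 ?mulr0 ?normr0 ?(ltW k0)// gtr0_norm.
have := Hd h; rewrite -ball_normE /= sub0r normrN.
move=> /(_ (le_lt_trans hn kd)); rewrite {2}/h dotZr dot_delta => H.
have -> : grad f x 0 j - k.+1%:R * (f (x + k.+1%:R^-1 *: delta_mx 0 j) - f x)
   = - (k.+1%:R * (f (x + h) - f x - k.+1%:R^-1 * grad f x 0 j)).
  by rewrite -/h [X in _ = - X]mulrBr mulVKf ?pnatr_eq0// opprB.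
rewrite normrN normrM gtr0_norm// -ler_pdivlMl//.
apply: (le_trans H); rewrite [leRHS]mulrC; rewrite ler_wpM2l// ltW//.
Unshelve. all: by end_near. Qed.
End differential.

Section jacobian.
Context {R : realType} {n m : nat}.
Implicit Types (y : 'rV[R]_n -> 'rV[R]_m) (u : 'rV[R]_n).

Lemma differentiable_coordP y u :
  (forall i, differentiable (fun v => y v 0 i : R^o) u) -> differentiable y u.
Proof.
move=> H; have -> : y = \sum_i (fun v => y v 0 i *: (delta_mx 0 i : 'rV[R]_m)).
  by apply/funext => v; rewrite fct_sumE [LHS]row_sum_delta.
by apply: differentiable_sum => i; apply: differentiableZl.
Qed.

Lemma coord_is_diff y u i : differentiable y u ->
  is_diff u (fun v => y v 0 i : R) (dot (row i (Jac y u))).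
Proof.
move=> dy; apply: is_diff_dot => e e0.
have /diff_locally/eqaddoP/(_ e e0) := dy.
apply: filterS => h; rewrite /= !fctE /= opprD addrA (addrC h).
apply: le_trans; have := row_coord_le (y (u + h) - y u - 'd y u h) i.
rewrite !mxE; congr (`|_ - _| <= _).
rewrite -(mul_rV_lin1 ('d y u)) mxE; apply: eq_bigr => j _.
by rewrite !mxE mulrC.
Qed.

Lemma differentiable_coord_row y u i :
  differentiable y u -> differentiable (fun v => y v 0 i : R) u.
Proof. by move=> /(coord_is_diff i)[]. Qed.

Lemma grad_coord y u i : differentiable y u ->
  grad (fun v => y v 0 i) u = row i (Jac y u).
Proof. by move=> dy; apply: grad_is_diff; exact: coord_is_diff. Qed.
End jacobian.

(** * Euclidean and operator norms *)

Section euclidean.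
Context {R : realType}.

Lemma dotC n (u v : 'rV[R]_n) : dot u v = dot v u.
Proof. by apply: eq_bigr => i _; rewrite mulrC. Qed.

Lemma dotBr n (p h k : 'rV[R]_n) : dot p (h - k) = dot p h - dot p k.
Proof. by rewrite dotC dotBl !(dotC _ p). Qed.

Lemma dotDl n (p q h : 'rV[R]_n) : dot (p + q) h = dot p h + dot q h.
Proof. by rewrite dotC dotDr !(dotC h). Qed.

Lemma dotZl n (p h : 'rV[R]_n) a : dot (a *: p) h = a * dot p h.
Proof. by rewrite dotC dotZr dotC. Qed.

Lemma dotvv_ge0 n (u : 'rV[R]_n) : 0 <= dot u u.
Proof. by apply: sumr_ge0 => i _; rewrite -expr2 sqr_ge0. Qed.

Lemma sqr_enorm n (u : 'rV[R]_n) : enorm u ^+ 2 = dot u u.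
Proof.
rewrite /enorm sqr_sqrtr; first by apply: eq_bigr => i _; rewrite expr2.
by apply: sumr_ge0 => i _; rewrite sqr_ge0.
Qed.

Lemma enorm_ge0 n (u : 'rV[R]_n) : 0 <= enorm u.
Proof. exact: sqrtr_ge0. Qed.

Lemma enorm_le n (u : 'rV[R]_n) r : 0 <= r -> dot u u <= r ^+ 2 -> enorm u <= r.
Proof. by move=> r0 H; rewrite -(@ler_pXn2r _ 2)// ?nnegrE ?enorm_ge0// sqr_enorm. Qed.

Lemma enorm_eq0 n (u : 'rV[R]_n) : enorm u = 0 -> u = 0.
Proof.
move=> H; have : dot u u = 0 by rewrite -sqr_enorm H expr0n.
move/eqP; rewrite psumr_eq0 => [/allP H0|i _]; last by rewrite -expr2 sqr_ge0.
apply/rowP => i; have := H0 i (mem_index_enum _).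
by rewrite mulf_eq0 orbb mxE => /eqP.
Qed.

Lemma enorm0 n : enorm (0 : 'rV[R]_n) = 0.
Proof. by rewrite /enorm big1 ?sqrtr0// => i _; rewrite mxE expr0n. Qed.

(** Cauchy-Schwarz, by expanding the square of [|v| u - |u| v]. *)
Lemma dot_enorm n (u v : 'rV[R]_n) : dot u v <= enorm u * enorm v.
Proof.
have [/eqP u0|u0] := boolP (enorm u == 0).
  by rewrite u0 (enorm_eq0 u0) mul0r dotC -(scale0r (0 : 'rV[R]_n)) dotZr mul0r.
have [/eqP v0|v0] := boolP (enorm v == 0).
  by rewrite v0 (enorm_eq0 v0) mulr0 -(scale0r (0 : 'rV[R]_n)) dotZr mul0r.
have ab0 : 0 < enorm u * enorm v by rewrite mulr_gt0// lt_neqAle eq_sym ?u0 ?v0 enorm_ge0.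
have := dotvv_ge0 (enorm v *: u - enorm u *: v).
rewrite !dotBl !dotBr !dotZl !dotZr -!sqr_enorm (dotC v u) => H.
have : 0 <= 2 * (enorm u * enorm v) * (enorm u * enorm v - dot u v).
  by apply: le_trans H _; rewrite le_eqVlt; apply/orP; left; apply/eqP; ring.
by rewrite pmulr_rge0 ?subr_ge0// mulr_gt0.
Qed.

Lemma enormN n (u : 'rV[R]_n) : enorm (- u) = enorm u.
Proof. by rewrite /enorm; congr Num.sqrt; apply: eq_bigr => i _; rewrite mxE sqrrN. Qed.

Lemma enormD n (u v : 'rV[R]_n) : enorm (u + v) <= enorm u + enorm v.
Proof.
apply: enorm_le; first by rewrite addr_ge0 ?enorm_ge0.
rewrite dotDl !dotDr (dotC v u) -!sqr_enorm.
have := dot_enorm u v; nra.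
Qed.

Lemma enormZ n a (u : 'rV[R]_n) : enorm (a *: u) = `|a| * enorm u.
Proof.
rewrite /enorm -sqrtr_sqr -sqrtrM ?sqr_ge0// mulr_sumr; congr Num.sqrt.
by apply: eq_bigr => i _; rewrite mxE exprMn.
Qed.

Lemma enorm_coord n (u : 'rV[R]_n) i : `|u 0 i| <= enorm u.
Proof.
rewrite -sqrtr_sqr ler_wsqrtr// (bigD1 i)//= lerDl.
by apply: sumr_ge0 => j _; rewrite sqr_ge0.
Qed.

Lemma norm_le_enorm n (u : 'rV[R]_n) : `|u| <= enorm u.
Proof.
by rewrite ler_row_norm ?enorm_ge0//; apply/forallP => i; exact: enorm_coord.
Qed.

Lemma enorm_le_sum n (u : 'rV[R]_n) : enorm u <= \sum_i `|u 0 i|.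
Proof.
rewrite [u in enorm u]row_sum_delta.
elim/big_ind2 : _ => [|a x b z H1 H2|i _]; first by rewrite enorm0.
  exact: le_trans (enormD _ _) (lerD H1 H2).
rewrite enormZ ler_piMr//; apply: enorm_le => //.
by rewrite dot_delta mxE !eqxx expr1n.
Qed.

Lemma dot_mulmx n (u v : 'rV[R]_n) : dot u v = (u *m v^T) 0 0.
Proof. by rewrite mxE; apply: eq_bigr => i _; rewrite mxE. Qed.

Lemma enorm_le_norm n (u : 'rV[R]_n) : enorm u <= n%:R * `|u|.
Proof.
apply: le_trans (enorm_le_sum u) _.
rewrite (@le_trans _ _ (\sum_(i < n) `|u|))//.
  by apply: ler_sum => i _; exact: row_coord_le.
by rewrite sumr_const card_ord mulr_natl.
Qed.
End euclidean.

Section operator_norm.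
Context {R : realType} {m n : nat}.
Implicit Types A B : 'M[R]_(m, n).

Lemma mulmx_tr_coord A (x : 'rV[R]_n) i : (x *m A^T) 0 i = dot (row i A) x.
Proof. by rewrite mxE; apply: eq_bigr => j _; rewrite !mxE mulrC. Qed.

Lemma enorm_mulmx_tr A (x : 'rV[R]_n) :
  enorm (x *m A^T) <= (\sum_i enorm (row i A)) * enorm x.
Proof.
apply: le_trans (enorm_le_sum _) _; rewrite mulr_suml; apply: ler_sum => i _.
rewrite mulmx_tr_coord ler_norml dot_enorm andbT lerNl.
apply: le_trans (_ : enorm (- row i A) * enorm x <= _); last by rewrite enormN.
apply: le_trans (dot_enorm _ _); by rewrite -(scaleN1r (row i A)) dotZl mulN1r.
Qed.

Lemma opnorm_has_sup A : has_sup [set enorm (x *m A^T) | x in eball 0 1].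
Proof.
split.
  by exists (enorm (0 *m A^T)), 0 => //; rewrite /eball /= subrr enorm0.
exists (\sum_i enorm (row i A)) => _ [z zb <-].
move: zb; rewrite /eball /= subr0 => z1.
apply: le_trans (enorm_mulmx_tr _ _) _; rewrite ler_piMr//.
by apply: sumr_ge0 => i _; exact: enorm_ge0.
Qed.

Lemma opnorm_le A (c : R) :
  (forall x, enorm x <= 1 -> enorm (x *m A^T) <= c) -> opnorm A <= c.
Proof.
move=> H; apply: ge_sup; first by case: (opnorm_has_sup A).
move=> _ [z zb <-]; apply: H.
by move: zb; rewrite /eball /= subr0.
Qed.

Lemma le_opnorm1 A (x : 'rV[R]_n) : enorm x <= 1 -> enorm (x *m A^T) <= opnorm A.
Proof.
move=> x1; apply: sup_upper_bound; first exact: opnorm_has_sup.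
by exists x => //; rewrite /eball /= subr0.
Qed.

Lemma opnorm_ge0 A : 0 <= opnorm A.
Proof.
have := @le_opnorm1 A 0; rewrite enorm0 => /(_ ler01).
by apply: le_trans; exact: enorm_ge0.
Qed.

Lemma le_opnorm A (x : 'rV[R]_n) : enorm (x *m A^T) <= opnorm A * enorm x.
Proof.
have [/eqP x0|x0] := boolP (enorm x == 0).
  by rewrite x0 (enorm_eq0 x0) mul0mx enorm0 mulr0.
have xp : 0 < enorm x by rewrite lt_neqAle eq_sym x0 enorm_ge0.
have := @le_opnorm1 A ((enorm x)^-1 *: x).
rewrite -scalemxAl !enormZ gtr0_norm ?invr_gt0// mulVf// => /(_ (lexx _)).
by rewrite ler_pdivrMl// mulrC.
Qed.

(** [opnorm] is defined through the action of [A^T] on the right, while hypergradients use that of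
    [A]. Adjointness turns the square of [|w A|] into the product of [w] with [(w A) A^T], and
    Cauchy-Schwarz concludes. *)
Lemma enorm_mulmx_opnorm (w : 'rV[R]_m) A : enorm (w *m A) <= enorm w * opnorm A.
Proof.
have [/eqP x0|x0] := boolP (enorm (w *m A) == 0).
  by rewrite x0 mulr_ge0 ?enorm_ge0 ?opnorm_ge0.
have xp : 0 < enorm (w *m A) by rewrite lt_neqAle eq_sym x0 enorm_ge0.
rewrite -(ler_pM2r xp) -expr2 sqr_enorm.
have -> : dot (w *m A) (w *m A) = dot w ((w *m A) *m A^T).
  by rewrite !dot_mulmx [in RHS]trmx_mul trmxK mulmxA.
apply: le_trans (dot_enorm _ _) _; rewrite -mulrA ler_wpM2l ?enorm_ge0//.
exact: le_opnorm.
Qed.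

Lemma opnormD A B : opnorm (A + B) <= opnorm A + opnorm B.
Proof.
apply: opnorm_le => x x1; rewrite linearD/= mulmxDr.
by apply: le_trans (enormD _ _) _; apply: lerD; exact: le_opnorm1.
Qed.

Lemma opnormZ a A : opnorm (a *: A) <= `|a| * opnorm A.
Proof.
apply: opnorm_le => x x1; rewrite linearZ/= -scalemxAr enormZ.
by rewrite ler_wpM2l//; exact: le_opnorm1.
Qed.

Lemma opnorm_le_norm A : opnorm A <= m%:R * (n%:R * `|A|).
Proof.
have mn0 : 0 <= m%:R * (n%:R * `|A|) by rewrite !mulr_ge0.
apply: opnorm_le => x x1; apply: le_trans (enorm_mulmx_tr _ _) _.
apply: (@le_trans _ _ (\sum_i enorm (row i A))).
  by rewrite ler_piMr// sumr_ge0// => i _; exact: enorm_ge0.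
apply: (@le_trans _ _ (\sum_(i < m) (n%:R * `|A|))); last first.
  by rewrite sumr_const card_ord -[leLHS]mulr_natl.
apply: ler_sum => i _; apply: le_trans (enorm_le_norm _) _; rewrite ler_wpM2l//.
rewrite ler_row_norm//; apply/forallP => j; rewrite mxE.
rewrite [leRHS]mx_normrE; apply/bigmax_geP; right => /=; by exists (i, j).
Qed.
End operator_norm.

(** * Means and convex sets *)

Section convexity.
Context {R : realType} {V : lmodType R}.
Implicit Types C : set V.

Lemma convex_setP C : convex_set C <->
  (forall x y (s : R), 0 <= s <= 1 -> C x -> C y -> C (s *: x + (1 - s) *: y)).
Proof.
split=> [cC x y s /andP[s0 s1] /mem_set Cx /mem_set Cy|H x y l /set_mem Cx /set_mem Cy].
  by have /set_mem := cC x y (Itv01 s0 s1) Cx Cy.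
apply/mem_set; apply: (H x y l%:num) => //.
by apply/andP; split.
Qed.

Lemma conv_hull_convex (A : set V) : convex_set (conv_hull A).
Proof.
apply/convex_setP => x y s s01 hx hy C [cC AC].
by apply: (convex_setP C).1 => //; [apply: hx|apply: hy].
Qed.

Lemma sub_conv_hull (A : set V) : A `<=` conv_hull A.
Proof. by move=> x Ax C [_]; exact. Qed.

Lemma conv_hull_sub (A C : set V) : convex_set C -> A `<=` C -> conv_hull A `<=` C.
Proof. by move=> cC AC x; apply. Qed.

(** Stated for an abstract seminorm because it serves twice: for matrices with [opnorm] and for rows
    with [enorm]. *)
Lemma near_convex (nn : V -> R) (K : set V) (r : R) :
  (forall a b, nn (a + b) <= nn a + nn b) ->
  (forall a v, nn (a *: v) <= `|a| * nn v) ->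
  convex_set K -> convex_set [set w | exists2 v, K v & nn (w - v) <= r].
Proof.
move=> nnD nnZ /convex_setP cK.
apply/convex_setP => a b s s01 [v Kv av] [v' Kv' bv].
have /andP[s0 s1] := s01.
exists (s *: v + (1 - s) *: v'); first exact: cK.
have -> : s *: a + (1 - s) *: b - (s *: v + (1 - s) *: v') =
  s *: (a - v) + (1 - s) *: (b - v').
  by rewrite !scalerBr opprD addrACA.
apply: (le_trans (nnD _ _)).
apply: (@le_trans _ _ (s * r + (1 - s) * r)); last by rewrite -mulrDl addrC subrK mul1r.
apply: lerD; apply: (le_trans (nnZ _ _)).
  by rewrite ger0_norm// ler_wpM2l.
by rewrite ger0_norm ?subr_ge0// ler_wpM2l ?subr_ge0.
Qed.
End convexity.

Section Rintegral_sum.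
Context d (T : measurableType d) (R : realType) (mu : {measure set T -> \bar R}).
Variables (D : set T) (mD : measurable D).

Lemma Rintegral_sum (I : Type) (s : seq I) (f : I -> T -> R) :
  (forall i, mu.-integrable D (EFin \o f i)) ->
  mu.-integrable D (EFin \o (fun t => \sum_(i <- s) f i t)) /\
  \int[mu]_(t in D) (\sum_(i <- s) f i t) = \sum_(i <- s) \int[mu]_(t in D) f i t.
Proof.
move=> fi; elim: s => [|i s [IH1 IH2]].
  under [X in EFin \o X]eq_fun do rewrite big_nil.
  under [X in Rintegral _ _ X]eq_fun do rewrite big_nil.
  rewrite big_nil Rintegral_cst// mul0r; split => //.
  exact: integrable0.
under [X in EFin \o X]eq_fun do rewrite big_cons.
under [X in Rintegral _ _ X]eq_fun do rewrite big_cons.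
rewrite big_cons RintegralD// IH2; split => //.
have := integrableD mD (fi i) IH1; apply: eq_integrable => // t _ /=.
Qed.

Lemma bounded_integrable (f : T -> R) (M : R) : (mu D < +oo)%E ->
  measurable_fun D f -> (forall t, D t -> `|f t| <= M) ->
  mu.-integrable D (EFin \o f).
Proof.
move=> Doo mf fM; apply: measurable_bounded_integrable => //.
exists M; split; first exact: num_real.
by move=> x Mx t Dt /=; rewrite (le_trans (fM _ Dt))// ltW.
Qed.
End Rintegral_sum.

Section mean.
Context d (T : measurableType d) (R : realType) (mu : {measure set T -> \bar R}).
Variables (D : set T) (mD : measurable D).
Hypotheses (D0 : (0 < mu D)%E) (Doo : (mu D < +oo)%E).

Definition mean (f : T -> R) : R := (fine (mu D))^-1 * \int[mu]_(t in D) f t.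

Let fmu0 : 0 < fine (mu D).
Proof. by rewrite fine_gt0// D0. Qed.

Lemma mean_cst (r : R) : mean (cst r) = r.
Proof. by rewrite /mean Rintegral_cst// mulrCA mulVf ?mulr1// gt_eqF. Qed.

Lemma le_mean (f g : T -> R) : mu.-integrable D (EFin \o f) ->
  mu.-integrable D (EFin \o g) -> (forall t, D t -> f t <= g t) ->
  mean f <= mean g.
Proof.
move=> fi gi fg; rewrite /mean ler_pM2l ?invr_gt0//.
exact: le_Rintegral.
Qed.

Lemma mean_dot n (p : 'rV[R]_n) (G : T -> 'rV[R]_n) :
  (forall j, mu.-integrable D (EFin \o (fun t => G t 0 j))) ->
  mu.-integrable D (EFin \o (fun t => dot p (G t))) /\
  mean (fun t => dot p (G t)) = dot p (\row_j mean (fun t => G t 0 j)).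
Proof.
move=> Gi.
have H j : mu.-integrable D (EFin \o (fun t => p 0 j * G t 0 j)).
  have := integrableZl mD (p 0 j) (Gi j); apply: eq_integrable => // t _ /=.
have [H1 H2] := Rintegral_sum mD (index_enum 'I_n) H; split; first exact: H1.
rewrite /mean /dot H2 mulr_sumr; apply: eq_bigr => j _.
by rewrite RintegralZl// mxE mulrCA.
Qed.

(* If [P] almost minimizes the distance from the mean [a] to [C], then
   [dot (a - P) (G t - P)] is small for every [t], and its mean is
   [dot (a - P) (a - P)]. *)
Lemma mean_near_convex n (C : set 'rV[R]_n) (G : T -> 'rV[R]_n) (M : R) :
  convex_set C -> (forall j, measurable_fun D (fun t => G t 0 j)) ->
  (forall t, D t -> C (G t)) -> (forall t j, D t -> `|G t 0 j| <= M) ->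
  forall e, 0 < e ->
  exists2 P, C P & enorm ((\row_j mean (fun t => G t 0 j)) - P) < e.
Proof.
move=> cC mG CG GM e e0.
have Gi j : mu.-integrable D (EFin \o (fun t => G t 0 j)).
  by apply: (@bounded_integrable _ _ _ _ _ mD _ M) => // t /GM.
have [t0 Dt0] : D !=set0.
  by apply/set0P/eqP => DE; move: D0; rewrite DE measure0 ltxx.
set a := \row_j _.
have aM j : `|a 0 j| <= M.
  rewrite mxE ler_norml; apply/andP; split.
    rewrite -(mean_cst (- M)); apply: le_mean => //.
      by apply: (@bounded_integrable _ _ _ _ _ mD _ `|M|) => // t _ /=; rewrite normrN.
    by move=> t /(GM _ j); rewrite ler_norml => /andP[].
  rewrite -[leRHS](mean_cst M); apply: le_mean => //.
    by apply: (@bounded_integrable _ _ _ _ _ mD _ `|M|).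
  by move=> t /(GM _ j); rewrite ler_norml => /andP[].
have [//|no] := pselect (exists2 P, C P & enorm (a - P) < e).
exfalso.
pose S := [set dot (a - P) (a - P) | P in C].
have S_inf : has_inf S.
  split; first by exists (dot (a - G t0) (a - G t0)), (G t0) => //; exact: CG.
  by exists 0 => _ [P _ <-]; exact: dotvv_ge0.
pose m := inf S.
have m0 : 0 < m.
  apply: (@lt_le_trans _ _ (e ^+ 2)); first by rewrite exprn_gt0.
  apply: lb_le_inf; first by case: S_inf.
  move=> _ [P CP <-]; rewrite -sqr_enorm ler_pXn2r ?nnegrE ?enorm_ge0 ?(ltW e0)//.
  by rewrite leNgt; apply/negP => lt; apply: no; exists P.
have mS P : C P -> m <= dot (a - P) (a - P).
  by move=> CP; apply: ge_inf; [case: S_inf|exists P].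
(* Each coordinate of [G t - P] is bounded through [a]: [G t] and [a] contribute [|M|] each, and
   [a - P] at most [m + 2]. The factor [n] passes to the Euclidean norm. *)
pose B : R := n%:R * (2 * `|M| + (m + 2)).
have B0 : 0 <= B.
  by rewrite /B mulr_ge0// addr_ge0 ?mulr_ge0// addr_ge0// ltW.
pose K : R := B ^+ 2.
have K0 : 0 <= K by exact: sqr_ge0.
have [k Hk] : exists k : nat, (1 + K) * k.+1%:R^-1 < m.
  by apply: mul_invS_lt => //; rewrite ltr_wpDr.
pose s : R := k.+1%:R^-1.
have s0 : 0 < s by rewrite invr_gt0.
have s1 : s <= 1 by rewrite invf_le1// ler1n.
(* [C] need not be closed, so the infimum may not be attained. The defect [s ^+ 2] is of the same
   order as the quadratic term in the next comparison. *)
have [_ [P CP <-] HP] : exists2 r, S r & r < m + s ^+ 2.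
  by apply: inf_adherent => //; rewrite exprn_gt0.
have aP j : `|a 0 j - P 0 j| <= m + 2.
  have := enorm_coord (a - P) j; rewrite !mxE => /le_trans; apply.
  apply: enorm_le; first by lra.
  by apply: ltW; apply: (lt_le_trans HP); nra.
(* Moving from [P] towards [G t] by the fraction [s] stays in [C], so the squared distance to [a]
   cannot fall below [m]. The linear gain [2 s] times the product is thus at most the defect plus
   [s ^+ 2 * K]. *)
have key t : D t -> dot (a - P) (G t - P) <= s * (1 + K) / 2.
  move=> Dt.
  have CPs : C (s *: G t + (1 - s) *: P).
    by apply: ((convex_setP C).1 cC) => //; [rewrite (ltW s0)|exact: CG].
  have := mS _ CPs.
  have -> : a - (s *: G t + (1 - s) *: P) = (a - P) - s *: (G t - P).
    by apply/rowP => j; rewrite /a !mxE; ring.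
  have sqB (u w : 'rV[R]_n) : dot (u - s *: w) (u - s *: w) =
      dot u u - 2 * s * dot u w + s ^+ 2 * dot w w.
    by rewrite dotBl !dotBr !dotZl !dotZr (dotC w u); ring.
  rewrite sqB => H.
  have GP : dot (G t - P) (G t - P) <= K.
    rewrite -sqr_enorm ler_pXn2r ?nnegrE ?enorm_ge0//.
    apply: le_trans (enorm_le_norm _) _; rewrite /B ler_wpM2l//.
    rewrite ler_row_norm; last by rewrite addr_ge0 ?mulr_ge0// addr_ge0// ltW.
    apply/forallP => j; rewrite !mxE.
    have := GM t j Dt; have := aM j; have := aP j; have := ler_norm M.
    by rewrite !ler_norml => ? /andP[? ?] /andP[? ?] /andP[? ?]; apply/andP; split; lra.
  have : s * (2 * dot (a - P) (G t - P)) <= s * (s * (1 + K)).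
    nra.
  rewrite ler_pM2l// => H2; lra.
have GPi j : mu.-integrable D (EFin \o (fun t => (G t - P) 0 j)).
  apply: (@bounded_integrable _ _ _ _ _ mD _ (M + `|P 0 j|)) => //.
    by under eq_fun do rewrite !mxE; apply: measurable_funB.
  move=> t Dt; rewrite !mxE (le_trans (ler_normB _ _))// lerD2r; exact: GM.
have [DPi DPE] := mean_dot (a - P) GPi.
have := le_mean DPi (g := cst (s * (1 + K) / 2)) _ key.
rewrite mean_cst DPE.
have -> : \row_j mean (fun t => (G t - P) 0 j) = a - P.
  apply/rowP => j; rewrite !mxE.
  under [X in mean X]eq_fun do rewrite !mxE.
  rewrite /mean RintegralB//; last first.
    by apply: (@bounded_integrable _ _ _ _ _ mD _ `|P 0 j|).
  by rewrite mulrBr Rintegral_cst// mulrCA mulVf ?mulr1// gt_eqF.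
have Ki : mu.-integrable D (EFin \o cst (s * (1 + K) / 2)).
  by apply: (@bounded_integrable _ _ _ _ _ mD _ `|s * (1 + K) / 2|).
move=> /(_ Ki); have := mS _ CP.
have : s * (1 + K) / 2 < m.
  apply: (le_lt_trans _ Hk); rewrite [leLHS]mulrC mulrA -/s.
  by have := mulr_ge0 (ltW s0) K0; lra.
lra.
Qed.
End mean.

(** * Smoothing over the ball *)

Section unit_ball.
Context {R : realType} {n : nat}.
Local Notation T := (measurableTypeR R).
Local Notation mu := (lebesgue_tuple n).

Definition unit_ball : set (n.-tuple T) := [set t | eball 0 1 (row_of_tuple t)].

Lemma enorm_lipschitz (u v : 'rV[R]_n) : `|enorm u - enorm v| <= n%:R * `|u - v|.
Proof.
have H (a b : 'rV[R]_n) : enorm a - enorm b <= n%:R * `|a - b|.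
  rewrite lerBlDr; apply: le_trans (_ : enorm (a - b) + enorm b <= _).
    by have := enormD (a - b) b; rewrite subrK.
  by rewrite lerD2r enorm_le_norm.
by rewrite ler_norml H andbT lerNl opprB distrC H.
Qed.

Lemma closed_eball (x : 'rV[R]_n) r : closed (eball x r).
Proof.
have cx : continuous (fun u : 'rV[R]_n => enorm (u - x) : R).
  apply: (@lipschitz_norm_continuous _ _ _ _ n%:R) => u v.
  apply: le_trans (enorm_lipschitz _ _) _.
  by rewrite opprB addrA subrK.
rewrite (_ : eball x r = (fun u => enorm (u - x)) @^-1` [set z | z <= r]); last by [].
by apply: preimage_closed; [move=> u _; exact: cx|exact: closed_le].
Qed.

Lemma measurable_unit_ball : measurable unit_ball.
Proof. by apply: measurable_row_closed; exact: closed_eball. Qed.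

Lemma unit_ball_lty : (mu unit_ball < +oo)%E.
Proof.
pose A (i : 'I_n) : set T := `[-1, 1]%classic.
have mA i : measurable (A i) by exact: measurable_itv.
apply: (@le_lt_trans _ _ (mu [set t | forall i, A i (tnth t i)])).
  apply: le_measure; rewrite ?inE.
  - exact: measurable_unit_ball.
  - rewrite (_ : mkset _ = \bigcap_(i in [set: 'I_n]) ((@tnth n T)^~ i @^-1` A i)).
      apply: fin_bigcap_measurable => [|i _]; first exact: finite_finset.
      by rewrite -[X in measurable X]setTI; exact: measurable_tnth.
    by apply/seteqP; split => t /= Bt i => [_|]; exact: Bt.
  move=> t; rewrite /unit_ball /eball /= subr0 => t1 i.
  by rewrite /A /= in_itv/= -ler_norml (le_trans _ t1)//;
    have := enorm_coord (row_of_tuple t) i; rewrite mxE.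
rewrite lebesgue_tuple_box//.
suff : (\prod_(i < n) lebesgue_measure (A i))%E \is a fin_num.
  by rewrite fin_numElt => /andP[].
elim/big_ind : _ => [//|a b a1 b1|i _]; first exact: fin_numM.
by rewrite /A lebesgue_measure_itv/=; case: ifP.
Qed.

Lemma unit_ball_gt0 : (0 < mu unit_ball)%E.
Proof.
(* A cube of half-side [1/(n+1)] fits in the Euclidean ball, since [enorm] is at most [n] times the
   sup norm; this choice also covers [n = 0]. *)
pose c : R := n.+1%:R^-1.
have c0 : 0 < c by rewrite invr_gt0.
pose A (i : 'I_n) : set T := `[-c, c]%classic.
have mA i : measurable (A i) by exact: measurable_itv.
apply: (@lt_le_trans _ _ (mu [set t | forall i, A i (tnth t i)])); last first.
  apply: le_measure; rewrite ?inE.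
  - rewrite (_ : mkset _ = \bigcap_(i in [set: 'I_n]) ((@tnth n T)^~ i @^-1` A i)).
      apply: fin_bigcap_measurable => [|i _]; first exact: finite_finset.
      by rewrite -[X in measurable X]setTI; exact: measurable_tnth.
    by apply/seteqP; split => t /= Bt i => [_|]; exact: Bt.
  - exact: measurable_unit_ball.
  move=> t /= At; rewrite /unit_ball /eball /= subr0.
  apply: le_trans (enorm_le_norm _) _.
  apply: (@le_trans _ _ (n.+1%:R * c)); last by rewrite /c mulfV.
  apply: ler_pM => //; first by rewrite ler_nat.
  rewrite ler_row_norm ?(ltW c0)//; apply/forallP => i.
  by rewrite mxE ler_norml; have := At i; rewrite /A /= in_itv.
rewrite lebesgue_tuple_box//; elim/big_ind : _ => [|a b a1 b1|i _].
- by rewrite lte_fin.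
- exact: mule_gt0.
- by rewrite /A lebesgue_measure_itv/= lte_fin gtrN// -EFinB lte_fin; lra.
Qed.
End unit_ball.

Section smoothing_diff.
Context {R : realType} {n : nat}.
Local Notation T := (measurableTypeR R).
Local Notation mu := (lebesgue_tuple n).
Variables (f : 'rV[R]_n -> R) (L : R) (x : 'rV[R]_n) (delta : R).
Hypothesis fL : forall u v, `|f u - f v| <= L * `|u - v|.
Variable Omega : set (n.-tuple T).
Hypotheses (mOmega : measurable Omega) (Omega_ae : mu (~` Omega) = 0%E).
Hypothesis Omega_diff :
  forall t, Omega t -> differentiable f (x + delta *: row_of_tuple t).

(** Outside [Omega] the value of [grad] carries no information, so all means are taken over [D],
    which has the measure of the whole ball. *)
Let D : set (n.-tuple T) := unit_ball `&` Omega.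
Let G (t : n.-tuple T) := grad f (x + delta *: row_of_tuple t).

Let mD : measurable D.
Proof. by apply: measurableI => //; exact: measurable_unit_ball. Qed.

Lemma measure_ball_ae : mu (unit_ball `&` Omega) = mu unit_ball.
Proof.
have mB := @measurable_unit_ball R n.
have mCO : measurable (~` Omega) by exact: measurableC.
apply/eqP; rewrite eq_le; apply/andP; split.
  by apply: le_measure; rewrite ?inE.
apply: (@le_trans _ _ (mu (unit_ball `&` Omega) + mu (~` Omega))%E); last first.
  by rewrite Omega_ae adde0.
apply: le_trans (measureU2 _ mD mCO); apply: le_measure; rewrite ?inE//.
  exact: measurableU.
by move=> t Bt; have [Ot|Ot] := pselect (Omega t); [left|right].
Qed.

Let Doo : (mu D < +oo)%E.
Proof. by rewrite measure_ball_ae unit_ball_lty. Qed.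

Let D0 : (0 < mu D)%E.
Proof. by rewrite measure_ball_ae unit_ball_gt0. Qed.

Let mf (u : 'rV[R]_n) : measurable_fun setT (fun t : n.-tuple T => f (u + delta *: row_of_tuple t)).
Proof.
apply: (@measurable_fun_row R n (fun v => f (u + delta *: v))).
apply: (@lipschitz_norm_continuous _ _ _ _ (`|L| * `|delta|)) => a b.
apply: le_trans (fL _ _) _.
rewrite opprD addrACA subrr add0r -scalerBr normrZ -mulrA ler_wpM2r//.
exact: ler_norm.
Qed.

Let mG j : measurable_fun D (fun t => G t 0 j).
Proof.
apply: (@measurable_fun_cvg _ _ _ _ (fun k t => k.+1%:R *
  (f (x + k.+1%:R^-1 *: delta_mx 0 j + delta *: row_of_tuple t)
   - f (x + delta *: row_of_tuple t)))).
  move=> k; apply: measurable_funM => //; apply: measurable_funB.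
    exact: measurable_funTS.
  exact: measurable_funTS.
move=> t [_ Ot]; have := grad_cvg (j := j) (Omega_diff Ot).
by under eq_fun do rewrite addrAC.
Qed.

Let G_le t j : D t -> `|G t 0 j| <= L.
Proof. by move=> [_ Ot]; apply: grad_lipschitz => //; exact: Omega_diff. Qed.

Let Gi j : mu.-integrable D (EFin \o (fun t => G t 0 j)).
Proof. by apply: (@bounded_integrable _ _ _ _ _ mD _ L) => // t Dt; exact: G_le. Qed.

Lemma unif_ball_meanE (h : 'rV[R]_n -> R) :
  mu.-integrable unit_ball (EFin \o (h \o @row_of_tuple R n)) ->
  unif_ball_mean h = mean mu D (h \o @row_of_tuple R n).
Proof.
have muD : mu D = mu unit_ball := measure_ball_ae.
move=> hi; rewrite /unif_ball_mean /mean.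
have -> : fine (mu D) = fine (mu unit_ball) by rewrite muD.
congr (_ * _).
rewrite /Rintegral; congr fine.
rewrite (@negligible_integral _ _ _ _ _ (~` Omega))//.
- by rewrite setDE setCK.
- exact: measurableC.
- exact: measurable_unit_ball.
Qed.

Let fball (u : 'rV[R]_n) t : D t ->
  `|f (u + delta *: row_of_tuple t)| <= `|f u| + `|L| * `|delta|.
Proof.
move=> [Bt _].
rewrite -[f (_ + _)](subrK (f u)) (le_trans (ler_normD _ _))// addrC lerD2l.
apply: le_trans (fL _ _) _; rewrite addrAC subrr add0r normrZ.
apply: (@le_trans _ _ (`|L| * (`|delta| * `|row_of_tuple t|))).
  by rewrite ler_wpM2r ?ler_norm// mulr_ge0.
rewrite ler_wpM2l// ler_piMr//; apply: le_trans (norm_le_enorm _) _.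
by move: Bt; rewrite /unit_ball /eball /= subr0.
Qed.

Let fi (u : 'rV[R]_n) : mu.-integrable D (EFin \o (fun t => f (u + delta *: row_of_tuple t))).
Proof.
apply: (@bounded_integrable _ _ _ _ _ mD _ (`|f u| + `|L| * `|delta|)) => //.
  exact: measurable_funTS.
by move=> t Dt; exact: fball.
Qed.

Let F (u : 'rV[R]_n) : R := mean mu D (fun t => f (u + delta *: row_of_tuple t)).
Let p : 'rV[R]_n := \row_j mean mu D (fun t => G t 0 j).

(** The first-order remainder of [f] divided by the size of the increment. It is bounded uniformly
    in [h] and tends to 0 pointwise on [D]; at [h = 0] the convention for the inverse makes it 0. *)
Let quot (h : 'rV[R]_n) (t : n.-tuple T) : R :=
  `|h|^-1 * (f (x + h + delta *: row_of_tuple t)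
             - f (x + delta *: row_of_tuple t) - dot h (G t)).

Let meanB (a b : n.-tuple T -> R) : mu.-integrable D (EFin \o a) ->
  mu.-integrable D (EFin \o b) ->
  mean mu D (fun t => a t - b t) = mean mu D a - mean mu D b.
Proof. by move=> ai bi; rewrite /mean RintegralB// mulrBr. Qed.

Let integrableB' (a b : n.-tuple T -> R) : mu.-integrable D (EFin \o a) ->
  mu.-integrable D (EFin \o b) -> mu.-integrable D (EFin \o (fun t => a t - b t)).
Proof.
move=> ai bi; have := integrableB mD ai bi; apply: eq_integrable => // t _ /=.
Qed.

Let dGi h : mu.-integrable D (EFin \o (fun t => dot h (G t))).
Proof. by have [] := mean_dot mD h Gi. Qed.

Let mean_quot h : mean mu D (quot h) = `|h|^-1 * (F (x + h) - F x - dot p h).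
Proof.
have ai := integrableB' (fi (x + h)) (fi x).
have bi := integrableB' ai (dGi h).
rewrite /quot {1}/mean RintegralZl// mulrCA; congr (_ * _).
rewrite -/(mean mu D _) meanB// meanB//.
by have [_ ->] := mean_dot mD h Gi; rewrite (dotC p).
Qed.

Let quot_le h t : D t -> `|quot h t| <= `|L| + n%:R * `|L|.
Proof.
move=> Dt; rewrite /quot normrM normfV normr_id.
have [/eqP->|h0] := boolP (`|h| == 0).
  by rewrite invr0 mul0r addr_ge0// mulr_ge0.
rewrite ler_pdivrMl; last by rewrite lt_neqAle eq_sym h0 normr_ge0.
apply: (le_trans (ler_normB _ _)); rewrite mulrDr; apply: lerD.
  apply: (le_trans (fL _ _)); rewrite opprD addrACA subrr addr0 addrAC subrr add0r.
  by rewrite mulrC ler_wpM2l// ler_norm.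
rewrite dotC mulrC; apply: dot_le => i; apply: le_trans (G_le i Dt) _.
exact: ler_norm.
Qed.

Let quot_cvg (h : nat -> 'rV[R]_n) t : h k @[k --> \oo] --> (0 : 'rV[R]_n) -> D t ->
  quot (h k) t @[k --> \oo] --> (0 : R).
Proof.
move=> h0 [_ Ot]; apply/cvgrPdist_le => e e0.
have H := near_diff_grad (Omega_diff Ot) e0.
have : \forall k \near \oo, `|f (x + delta *: row_of_tuple t + h k)
   - f (x + delta *: row_of_tuple t) - dot (grad f (x + delta *: row_of_tuple t)) (h k)|
    <= e * `|h k| by exact: (h0 _ H).
apply: filterS => k Hk; rewrite sub0r normrN /quot normrM normfV normr_id.
have [/eqP->|hk] := boolP (`|h k| == 0); first by rewrite invr0 mul0r ltW.
rewrite ler_pdivrMl; last by rewrite lt_neqAle eq_sym hk normr_ge0.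
rewrite mulrC; move: Hk; rewrite (addrAC x (delta *: _)) [dot (grad _ _) _]dotC; exact: id.
Qed.

Let mquot h : measurable_fun D (quot h).
Proof.
apply: measurable_funM => //; apply: measurable_funB.
  by apply: measurable_funB; exact: measurable_funTS.
rewrite /dot; apply: measurable_sum => i.
by apply: measurable_funM.
Qed.

(* Dominated convergence along a sequence of increments that would contradict
   differentiability. *)
Lemma mean_is_diff : is_diff x F (dot p).
Proof.
apply: is_diff_dot => e e0.
have [[k Hk]|no] := pselect (exists k : nat, forall h, `|h| < k.+1%:R^-1 ->
    `|F (x + h) - F x - dot p h| <= e * `|h|).
  apply/nbhs_ballP; exists k.+1%:R^-1 => /=; first by rewrite invr_gt0.
  by move=> h; rewrite -ball_normE /= sub0r normrN; exact: Hk.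
have no' k : exists h, `|h| < k.+1%:R^-1 /\ e * `|h| < `|F (x + h) - F x - dot p h|.
  apply: contrapT => nh; apply: no; exists k => h hk; rewrite leNgt; apply/negP => lt.
  by apply: nh; exists h.
have [h Hh] := choice no'.
have h0 : h k @[k --> \oo] --> (0 : 'rV[R]_n).
  apply/cvgrPdist_lt => d d0; near=> k.
  rewrite sub0r normrN (lt_trans (Hh k).1)//.
  by near: k; exact: (near_infty_natSinv_lt (PosNum d0)).
have c1 k : measurable_fun D (fun t => (quot (h k) t)%:E).
  by apply/measurable_EFinP; exact: mquot.
have c2 : measurable_fun D (cst 0%E : n.-tuple T -> \bar R) by exact: measurable_cst.
have c3 : {ae mu, forall t, D t -> (quot (h k) t)%:E @[k --> \oo] --> cst 0%E t}.
  apply: aeW => t Dt; apply: cvg_EFin; first exact: nearW.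
  exact: quot_cvg.
have c4 : mu.-integrable D (cst (`|L| + n%:R * `|L|)%:E).
  by apply: (@bounded_integrable _ _ _ _ _ mD (cst (`|L| + n%:R * `|L|))
    (Num.norm (`|L| + n%:R * `|L|))).
have c5 : {ae mu, forall t, forall k, D t ->
    (`|(quot (h k) t)%:E| <= cst (`|L| + n%:R * `|L|)%:E t)%E}.
  by apply: aeW => t k Dt; rewrite lee_fin; exact: quot_le.
have [_ _] := dominated_convergence mD c1 c2 c3 c4 c5.
rewrite integral0 => /fine_cvgP[_ /cvgrPdist_lt H].
have muD0 : 0 < fine (mu D) by rewrite fine_gt0// D0.
have e1 : 0 < e * fine (mu D) by rewrite mulr_gt0.
have [k /=] := filter_ex (H _ e1); rewrite sub0r normrN => Hk.
have [_ Hk2] := Hh k.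
(* A zero increment would have zero remainder and could not violate the estimate, so dividing by
   [|h k|] is legitimate. *)
have hk0 : 0 < `|h k|.
  rewrite lt_neqAle normr_ge0 andbT eq_sym normr_eq0; apply/eqP => E.
  move: Hk2; rewrite E addr0 subrr normr0 mulr0 sub0r normrN.
  by rewrite -(scale0r (0 : 'rV[R]_n)) dotZr mul0r normr0 ltxx.
have := mean_quot (h k); rewrite /mean => /(congr1 Num.norm).
rewrite !normrM !normfV (gtr0_norm muD0) normr_id => E.
have : e < `|h k|^-1 * `|F (x + h k) - F x - dot p (h k)|.
  by rewrite ltr_pdivlMl// mulrC.
by rewrite -E ltr_pdivlMl// mulrC ltNge ltW.
Unshelve. all: by end_near. Qed.

Lemma unif_ball_mean_is_diff :
  is_diff x (fun u => unif_ball_mean (fun xi => f (u + delta *: xi))) (dot p).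
Proof.
rewrite (_ : (fun u => _) = F); first exact: mean_is_diff.
apply/funext => u; apply: (@unif_ball_meanE (fun xi => f (u + delta *: xi))).
apply: (@bounded_integrable _ _ _ _ _ measurable_unit_ball _ (`|f u| + `|L| * `|delta|)).
- exact: unit_ball_lty.
- exact: (measurable_funTS (mf u)).
- move=> t; rewrite /unit_ball /eball /= subr0 => t1.
  rewrite -[f (_ + _)](subrK (f u)) (le_trans (ler_normD _ _))// addrC lerD2l.
  apply: le_trans (fL _ _) _; rewrite addrAC subrr add0r normrZ.
  apply: (@le_trans _ _ (`|L| * (`|delta| * `|row_of_tuple t|))).
    by rewrite ler_wpM2r ?ler_norm// mulr_ge0.
  rewrite ler_wpM2l// ler_piMr//; exact: le_trans (norm_le_enorm _) _.
Qed.

Lemma grad_measurable j : measurable_fun D (fun t => G t 0 j).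
Proof. exact: mG. Qed.

Lemma grad_bounded t j : D t -> `|G t 0 j| <= L.
Proof. exact: G_le. Qed.

Lemma ball_domain : [/\ measurable D, (0 < mu D)%E & (mu D < +oo)%E].
Proof. by split; [exact: mD|exact: D0|exact: Doo]. Qed.
End smoothing_diff.

Section smoothing_jacobian.
Context {R : realType} {n m : nat}.
Local Notation T := (measurableTypeR R).
Local Notation mu := (lebesgue_tuple n).
Variables (Y : 'rV[R]_n -> 'rV[R]_m) (L : R) (x : 'rV[R]_n) (delta : R).
Hypothesis YL : forall i u v, `|Y u 0 i - Y v 0 i| <= L * `|u - v|.
Hypothesis delta0 : 0 < delta.

(** Rademacher's theorem is applied to the rescaled function of the ball variable. The null set then
    lies where the mean is taken, and Lebesgue measure needs no change of variables. *)
Let Omega : set (n.-tuple T) := \bigcap_(i in [set: 'I_m])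
  [set t | wdiff (fun v => Y (x + delta *: v) 0 i) id (row_of_tuple t)].

Let YdL i u v : `|Y (x + delta *: u) 0 i - Y (x + delta *: v) 0 i| <= (L * delta) * `|u - v|.
Proof.
apply: le_trans (YL _ _ _) _.
by rewrite opprD addrACA subrr add0r -scalerBr normrZ gtr0_norm// mulrA.
Qed.

Let mOmega : measurable Omega.
Proof.
apply: fin_bigcap_measurable => [|i _]; first exact: finite_finset.
apply: measurable_wdiff; exact: (lipschitz_norm_continuous (YdL i)).
Qed.

Let Omega_ae : mu (~` Omega) = 0%E.
Proof.
apply/negligibleP; first exact: measurableC.
have := @ae_countable R _ _ mu 'I_m (fun i t =>
  wdiff (fun v => Y (x + delta *: v) 0 i) id (row_of_tuple t)) (fun i => ae_wdiff (YdL i)).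
by apply: negligibleS => t nt H; apply: nt => i _; exact: H.
Qed.

(** Undoes the rescaling by composing with the inverse affine map [k]. *)
Let Omega_diffi i t : Omega t -> differentiable (fun v => Y v 0 i) (x + delta *: row_of_tuple t).
Proof.
move=> /(_ i Logic.I)/wdiff_differentiable; set u := row_of_tuple t => H.
pose k (v : 'rV[R]_n) : 'rV[R]_n := delta^-1 *: (v - x).
have kE : k (x + delta *: u) = u.
  by rewrite /k addrAC subrr add0r scalerA mulVf ?scale1r// gt_eqF.
have dk : differentiable k (x + delta *: u).
  apply: differentiableZ; apply: differentiableB => //; exact: differentiable_cst.
have -> : (fun v => Y v 0 i) = (fun v => Y (x + delta *: v) 0 i : R) \o k.
  apply/funext => v; rewrite /k /= scalerA mulfV ?gt_eqF// scale1r.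
  by rewrite addrC subrK.
by apply: differentiable_comp => //; rewrite kE.
Qed.

Let Omega_diff t : Omega t -> differentiable Y (x + delta *: row_of_tuple t).
Proof. by move=> Ot; apply: differentiable_coordP => i; exact: Omega_diffi. Qed.

Let D : set (n.-tuple T) := unit_ball `&` Omega.

Let smoothing_coord_diff i : is_diff x (fun u => smoothing Y delta u 0 i)
  (dot (\row_j mean mu D (fun t => Jac Y (x + delta *: row_of_tuple t) i j))).
Proof.
have H := unif_ball_mean_is_diff (YL i) mOmega Omega_ae (@Omega_diffi i).
have E : (\row_j mean mu D (fun t => Jac Y (x + delta *: row_of_tuple t) i j)) =
  \row_j mean mu D (fun t => grad (fun v => Y v 0 i) (x + delta *: row_of_tuple t) 0 j).
  apply/rowP => j; rewrite !mxE /mean; congr (_ * _).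
  apply: eq_Rintegral => t /set_mem[_ Ot].
  by rewrite grad_coord ?mxE//; exact: Omega_diff.
rewrite E (_ : (fun u => _) = fun u => unif_ball_mean (fun xi => Y (u + delta *: xi) 0 i))//.
by apply/funext => u; rewrite mxE.
Qed.

Lemma differentiable_smoothing : differentiable (smoothing Y delta) x.
Proof. by apply: differentiable_coordP => i; case: (smoothing_coord_diff i). Qed.

Lemma ex_differentiable : exists2 s, eball x delta s & differentiable Y s.
Proof.
have [_ D0 _] := ball_domain mOmega Omega_ae.
have [t [Bt Ot]] : D !=set0.
  by apply/set0P/eqP => DE; move: D0; rewrite -/D DE measure0 ltxx.
exists (x + delta *: row_of_tuple t); last exact: Omega_diff.
rewrite /eball /= addrAC subrr add0r enormZ gtr0_norm// ler_piMr ?(ltW delta0)//.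
by move: Bt; rewrite /unit_ball /eball /= subr0.
Qed.

(** Multiplying by [w] before taking the mean turns matrices into rows, so the Euclidean argument
    for means in convex sets applies directly. *)
Lemma smoothing_jac_near (w : 'rV[R]_m) (C : set 'rV[R]_n) : convex_set C ->
  (forall s, eball x delta s -> differentiable Y s -> C (w *m Jac Y s)) ->
  forall e, 0 < e ->
  exists2 P, C P & enorm (w *m Jac (smoothing Y delta) x - P) < e.
Proof.
move=> cC CJ e e0.
have [mD D0 Doo] := ball_domain mOmega Omega_ae.
pose J t := Jac Y (x + delta *: row_of_tuple t).
have JE i j t : D t -> J t i j = grad (fun v => Y v 0 i) (x + delta *: row_of_tuple t) 0 j.
  by move=> [_ Ot]; rewrite grad_coord ?mxE//; exact: Omega_diff.
have mJ i j : measurable_fun D (fun t => J t i j).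
  have := grad_measurable (YL i) (@Omega_diffi i) j.
  apply: eq_measurable_fun => t /set_mem Dt; by rewrite JE.
have bJ i j t : D t -> `|J t i j| <= L.
  by move=> Dt; rewrite JE//; apply: (grad_bounded (YL i) (@Omega_diffi i) j Dt).
have Ji i j : mu.-integrable D (EFin \o (fun t => J t i j)).
  by apply: (@bounded_integrable _ _ _ _ _ mD _ L) => // t Dt; exact: bJ.
have GE t j : (w *m J t) 0 j = dot w (\row_i J t i j).
  by rewrite mxE; apply: eq_bigr => i _; rewrite mxE.
have mG j : measurable_fun D (fun t => (w *m J t) 0 j).
  under eq_fun do rewrite mxE; apply: measurable_sum => i.
  by apply: measurable_funM.
have CG t : D t -> C (w *m J t).
  move=> [Bt Ot]; apply: CJ; last exact: Omega_diff.
  rewrite /eball /= addrAC subrr add0r enormZ gtr0_norm// ler_piMr ?(ltW delta0)//.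
  by move: Bt; rewrite /unit_ball /eball /= subr0.
have bG t j : D t -> `|(w *m J t) 0 j| <= m%:R * `|L| * `|w|.
  move=> Dt; rewrite GE dotC; apply: dot_le => i; rewrite mxE.
  by apply: (le_trans (bJ _ _ _ Dt)); exact: ler_norm.
have [P CP HP] := mean_near_convex mD D0 Doo cC mG CG bG e0.
exists P => //; move: HP; congr (enorm (_ - _) < _).
apply/rowP => j; rewrite [LHS]mxE [RHS]mxE.
have -> : (fun t => (w *m J t) 0 j) = (fun t => dot w (\row_i J t i j)).
  by apply/funext => t; exact: GE.
have JiR i : mu.-integrable D (EFin \o (fun t => (\row_i J t i j) 0 i)).
  rewrite (_ : (fun t => _) = (fun t => J t i j))//.
  by apply/funext => t; rewrite mxE.
have [_ ->] := mean_dot mD w JiR; apply: eq_bigr => i _; congr (_ * _).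
have := grad_is_diff (smoothing_coord_diff i).
rewrite grad_coord; last exact: differentiable_smoothing.
have rowE k (A : 'M[R]_(m, k)) l : row i A 0 l = A i l by rewrite mxE.
have rvE k (h : 'I_k -> R) l : (\row_l h l) 0 l = h l by rewrite mxE.
move=> E; rewrite -[RHS]rowE E [RHS]rvE [LHS]rvE.
by congr (mean _ _ _); apply/funext => t; rewrite rvE.
Qed.
End smoothing_jacobian.

(** * Clarke objects of locally Lipschitz maps *)

Section near_diff.
Context {R : realType}.

Lemma near_eq_is_diff (V W : normedModType R) (f g : V -> W) (x : V) :
  (\forall u \near x, f u = g u) -> differentiable f x ->
  is_diff x g ('d f x).
Proof.
move=> fg df; have fgx : f x = g x by exact: nbhs_singleton fg.
apply: (is_diff_near (A := 'd f x)); first exact: diff_continuous.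
move=> e e0; have /diff_locally/eqaddoP/(_ e e0) := df.
have : \forall h \near (0 : V), f (h + x) = g (h + x).
  by move: fg; rewrite (near_shift 0 x) /= subr0.
apply: filterS2 => h fgh.
by rewrite /= !fctE /= fgh fgx opprD addrA (addrC h).
Qed.

Lemma near_eq_Jac n m (f g : 'rV[R]_n -> 'rV[R]_m) (x : 'rV[R]_n) :
  (\forall u \near x, f u = g u) -> differentiable f x ->
  differentiable g x /\ Jac g x = Jac f x.
Proof.
move=> fg df; have [dg dE] := near_eq_is_diff fg df; split; first exact: dg.
have JacE (h : 'rV[R]_n -> 'rV[R]_m) i j : Jac h x i j = 'd h x (delta_mx 0 j) 0 i.
  by rewrite /Jac mxE /jacobian mxE.
apply/matrixP => i j; apply: etrans (JacE g i j) _; apply: etrans _ (esym (JacE f i j)).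
exact: (congr1 (fun F : 'rV[R]_n -> 'rV[R]_m => F (delta_mx 0 j) 0 i) dE).
Qed.
End near_diff.

Section mcshane.
Context {R : realType} {V : normedModType R}.

(** McShane's construction: the lower envelope of the cones of slope [L] standing on the graph of
    [g]. *)
Lemma lipschitz_extension (S : set V) (g : V -> R) (L : R) : 0 <= L ->
  (forall u v, S u -> S v -> `|g u - g v| <= L * `|u - v|) ->
  exists G : V -> R, (forall u v, `|G u - G v| <= L * `|u - v|) /\
    (forall u, S u -> G u = g u).
Proof.
move=> L0 gL.
have [[u0 Su0]|S0] := pselect (S !=set0); last first.
  exists (fun _ => 0); split => [u v|u Su]; first by rewrite subrr normr0 mulr_ge0.
  by exfalso; apply: S0; exists u.
pose E z := [set g u + L * `|z - u| | u in S].
have Einf z : has_inf (E z).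
  split; first by exists (g u0 + L * `|z - u0|), u0.
  exists (g u0 - L * `|z - u0|) => _ [u Su <-].
  have := gL _ _ Su0 Su; rewrite ler_norml => /andP[_ H].
  have : L * `|u0 - u| <= L * `|z - u0| + L * `|z - u|.
    by rewrite -mulrDr ler_wpM2l// (distrC z u0) -(subrKA z u0) ler_normD.
  lra.
pose G z := inf (E z).
have GL z z' : G z <= G z' + L * `|z - z'|.
  rewrite -lerBlDr; apply: lb_le_inf; first by case: (Einf z').
  move=> _ [u Su <-]; rewrite lerBlDr.
  apply: (@le_trans _ _ (g u + L * `|z - u|)).
    by apply: ge_inf; [case: (Einf z)|exists u].
  by rewrite -addrA lerD2l -mulrDr ler_wpM2l// [leRHS]addrC ler_distD.
exists G; split => [u v|u Su].
  rewrite ler_norml; apply/andP; split.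
    by have := GL v u; rewrite (distrC v u); lra.
  by have := GL u v; lra.
apply/eqP; rewrite eq_le; apply/andP; split.
  apply: ge_inf; first by case: (Einf u).
  by exists u => //; rewrite subrr normr0 mulr0 addr0.
apply: lb_le_inf; first by case: (Einf u).
move=> _ [v Sv <-]; have := gL _ _ Su Sv; rewrite ler_norml => /andP[_]; lra.
Qed.
End mcshane.

Section bolzano.
Context {R : realType}.

Lemma mx_coord_le m n (A : 'M[R]_(m, n)) i j : `|A i j| <= `|A|.
Proof. by rewrite [leRHS]mx_normrE; apply/bigmax_geP; right => /=; exists (i, j). Qed.

Lemma mx_norm_le m n (A : 'M[R]_(m, n)) (r : R) : 0 <= r ->
  (forall i j, `|A i j| <= r) -> `|A| <= r.
Proof. by move=> r0 H; rewrite [`|A|]mx_normrE; apply/bigmax_leP; split => // -[i j] _ /=. Qed.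

Lemma norm_mxvec m n (A : 'M[R]_(m, n)) : `|mxvec A| = `|A|.
Proof.
apply/eqP; rewrite eq_le; apply/andP; split; apply: mx_norm_le => // i j.
  by rewrite (ord1 i); case/mxvec_indexP: j => k l; rewrite mxvecE mx_coord_le.
by rewrite -mxvecE row_coord_le.
Qed.

(** Bolzano-Weierstrass, transported from rows to matrices by [mxvec], which preserves the sup
    norm. *)
Lemma bounded_mx_seq_cluster m n (A : nat -> 'M[R]_(m, n)) (M : R) :
  (forall k, `|A k| <= M) ->
  exists V, forall l : nat, exists2 k, (l <= k)%N & `|A k - V| < l.+1%:R^-1.
Proof.
move=> AM.
have cB : compact [set v : 'rV[R]_(m * n) | forall i, v 0 i \in `[- M, M]].
  by apply: (@rV_compact _ _ (fun=> `[- M, M]%classic)) => _; exact: segment_compact.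
have FA : ((fun k => mxvec (A k)) @ \oo) [set v : 'rV[R]_(m * n) | forall i, v 0 i \in `[- M, M]].
  exists 0%N => // k _ i /=; rewrite in_itv/= -ler_norml.
  by apply: le_trans (AM k); rewrite -norm_mxvec row_coord_le.
have [v [_ cv]] := cB _ _ FA.
exists (vec_mx v) => l.
have l0 : 0 < l.+1%:R^-1 :> R by rewrite invr_gt0.
have [||w [[k /= lk kw] wv]] := cv [set mxvec (A k) | k in [set k | (l <= k)%N]] (ball v l.+1%:R^-1).
- by exists l => // k lk; exists k.
- exact: nbhsx_ballx.
exists k => //; rewrite -norm_mxvec linearB/= vec_mxK.
by move: wv; rewrite -kw -ball_normE /= distrC.
Qed.
End bolzano.

Section clarke_subdifferential.
Context {R : realType} {n m : nat}.
Implicit Types (F : 'rV[R]_n -> 'rV[R]_m) (N : set 'rV[R]_n).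

(** The Bouligand differential, whose convex hull is [clarke_jac]. *)
Definition jac_limits N F (x : 'rV[R]_n) : set 'M[R]_(m, n) :=
  [set V | exists xk : nat -> 'rV[R]_n,
    [/\ forall k, N (xk k) /\ differentiable F (xk k),
        xk k @[k --> \oo] --> x
      & Jac F (xk k) @[k --> \oo] --> V]].

Lemma clarke_jac_Jac N F s : N s -> differentiable F s -> clarke_jac N F s (Jac F s).
Proof.
move=> Ns dF; apply: sub_conv_hull; exists (fun=> s).
by split; [move=> _; split|exact: cvg_cst|exact: cvg_cst].
Qed.

Lemma clarke_jac_convex N F s : convex_set (clarke_jac N F s).
Proof. exact: conv_hull_convex. Qed.

(** Otherwise some sequence tending to [x] has Jacobians at distance at least [e] from every limit.
    They are bounded, so they cluster at some [V], which is itself such a limit. *)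
Lemma jac_limits_near N F x (r M : R) : 0 < r ->
  (forall u, `|u - x| < r -> N u -> differentiable F u -> `|Jac F u| <= M) ->
  forall e, 0 < e -> exists2 rho, 0 < rho & forall u, `|u - x| < rho -> N u ->
    differentiable F u -> exists2 V, jac_limits N F x V & `|Jac F u - V| < e.
Proof.
move=> r0 FM e e0; apply: contrapT => no.
have [k0 Hk0] : exists k0 : nat, 1 * k0.+1%:R^-1 < r by exact: mul_invS_lt.
rewrite mul1r in Hk0.
(* The offset [k0] keeps every radius below [r], where the bound [M] is available. *)
pose rad (k : nat) : R := (k0 + k).+1%:R^-1.
have rad0 k : 0 < rad k by rewrite invr_gt0.
have H k : exists u, [/\ `|u - x| < rad k, N u, differentiable F u &
    forall V, jac_limits N F x V -> e <= `|Jac F u - V| ].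
  apply: contrapT => nH; apply: no; exists (rad k) => // u ux Nu dF.
  apply: contrapT => nV; apply: nH; exists u; split => // V LV.
  by rewrite leNgt; apply/negP => lt; apply: nV; exists V.
have [u Hu] := choice H.
have radr k : rad k < r.
  by apply: le_lt_trans Hk0; rewrite lef_pV2 ?posrE// ler_nat ltnS leq_addr.
have uM k : `|Jac F (u k)| <= M.
  by have [ux Nu dF _] := Hu k; apply: FM => //; exact: lt_trans (radr k).
have [V HV] := bounded_mx_seq_cluster uM.
have HV' l : exists k, (l <= k)%N /\ `|Jac F (u k) - V| < l.+1%:R^-1.
  by have [k lk kV] := HV l; exists k.
have [s Hs] := choice HV'.
have LV : jac_limits N F x V.
  exists (u \o s); split.
  - by move=> k; have [_ Nu dF _] := Hu (s k).
  - apply/cvgrPdist_lt => d d0; near=> k; rewrite distrC /=.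
    have [ux _ _ _] := Hu (s k); apply: (lt_trans ux).
    apply: (@le_lt_trans _ _ k.+1%:R^-1).
      by rewrite lef_pV2 ?posrE// ler_nat ltnS (leq_trans (Hs k).1)// leq_addl.
    by near: k; exact: (near_infty_natSinv_lt (PosNum d0)).
  - apply/cvgrPdist_lt => d d0; near=> k; rewrite distrC /=.
    apply: (lt_trans (Hs k).2).
    by near: k; exact: (near_infty_natSinv_lt (PosNum d0)).
have [l Hl] : exists l : nat, 1 * l.+1%:R^-1 < e by exact: mul_invS_lt.
rewrite mul1r in Hl.
have [_ _ _ HVe] := Hu (s l).
by have := HVe V LV; rewrite leNgt (lt_trans (Hs l).2 Hl).
Unshelve. all: by end_near. Qed.

Lemma set_dist_opnorm_lt (V : 'M[R]_(m, n)) (K : set 'M[R]_(m, n)) (r : R) :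
  (set_dist (@opnorm R m n) V K < r%:E)%E -> exists2 V', K V' & opnorm (V - V') < r.
Proof.
move=> /ereal_inf_lt[_ [V' KV' <-]]; rewrite lte_fin => H; by exists V'.
Qed.

Lemma set_dist_ge0 (V : zmodType) (nn : V -> R) z (S : set V) :
  (forall v, 0 <= nn v) -> (0 <= set_dist nn z S)%E.
Proof.
by move=> H; apply: le_ereal_inf_tmp => _ [s _ <-]; rewrite lee_fin.
Qed.

Lemma set_dist_le (V : zmodType) (nn : V -> R) z (S : set V) s :
  S s -> (set_dist nn z S <= (nn (z - s))%:E)%E.
Proof. by move=> Ss; apply: ge_ereal_inf; exists (nn (z - s))%:E => //; exists s. Qed.

(** Upper semicontinuity at [x]. The matrices within [e] of the Clarke Jacobian at [x] form a convex
    set, so only the generators at [s] matter. Each of them is approached by Jacobians at points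
    near [s], hence near [x], where [jac_limits_near] applies. *)
Lemma clarke_variation_le N F x (r M : R) : 0 < r ->
  (forall u, `|u - x| < r -> N u -> differentiable F u -> `|Jac F u| <= M) ->
  forall e, 0 < e -> exists2 rho, 0 < rho & forall delta, delta < rho ->
    (clarke_variation N F x delta <= e%:E)%E.
Proof.
move=> r0 FM e e0.
(* [m * n] compares [opnorm] with the sup norm and the 1 makes [c] positive. The 2 in [e'] counts
   two moves: from [V] to a Jacobian, and from there to a limit at [x]. *)
pose c : R := m%:R * n%:R + 1.
have c0 : 0 < c by rewrite ltr_wpDl// mulr_ge0.
pose e' := e / (2 * c).
have e'0 : 0 < e' by rewrite divr_gt0// mulr_gt0.
have [rho rho0 H] := jac_limits_near r0 FM e'0.
exists rho => // delta drho.
apply: ge_ereal_sup => _ [s sx <-]; apply: ge_ereal_sup => _ [V KV <-].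
pose C := [set M | exists2 V, clarke_jac N F x V & opnorm (M - V) <= e].
suff [V' KV' VV'] : C V.
  by apply: le_trans (set_dist_le _ _ KV') _; rewrite lee_fin.
move: V KV; apply: conv_hull_sub.
  apply: near_convex; [exact: opnormD|exact: opnormZ|exact: clarke_jac_convex].
move=> V [xk [Nxk xks xkV]].
have sr : `|s - x| < rho.
  exact: le_lt_trans (norm_le_enorm _) (le_lt_trans sx drho).
have d0 : 0 < rho - `|s - x| by rewrite subr_gt0.
have /cvgrPdist_lt/(_ _ d0) H1 := xks.
have /cvgrPdist_lt/(_ _ e'0) H2 := xkV.
have [k [Hk1 Hk2]] := filter_ex (filterI H1 H2).
have [Nk dk] := Nxk k.
have [|V' LV' HV'] := H (xk k) _ Nk dk.
  rewrite -(subrKA s) (le_lt_trans (ler_normD _ _))//.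
  by rewrite -ltrBrDr distrC.
exists V'; first exact: sub_conv_hull.
apply: le_trans (opnorm_le_norm _) _; rewrite mulrA.
have VV : `|V - V'| <= 2 * e'.
  rewrite -(subrKA (Jac F (xk k))) (le_trans (ler_normD _ _))//.
  by rewrite mulr_natl mulr2n lerD// ltW.
apply: (@le_trans _ _ (c * (2 * e'))).
  by apply: ler_pM; rewrite ?mulr_ge0// /c lerDl.
rewrite /e' le_eqVlt; apply/orP; left; apply/eqP; field.
by rewrite gt_eqF.
Qed.
End clarke_subdifferential.

Section local_extension.
Context {R : realType} {n m : nat}.
Variables (N : set 'rV[R]_n) (y : 'rV[R]_n -> 'rV[R]_m).
Hypotheses (N_open : open N) (y_loclip : locally_lipschitz N y).

(** A single integer [k] serves as bound, Lipschitz constant and inverse radius. All three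
    requirements hold for large [k] near each point of [K], so compactness makes them hold for one
    [k]. *)
Lemma local_lipschitz_uniform (K : set 'rV[R]_n) : compact K -> K `<=` N ->
  exists k : nat, forall u, K u -> enorm (y u) <= k%:R /\
    forall v w, `|v - u| < k.+1%:R^-1 -> `|w - u| < k.+1%:R^-1 ->
      N v /\ enorm (y v - y w) <= k%:R * enorm (v - w).
Proof.
move=> cK KN.
pose P (k : nat) u := enorm (y u) <= k%:R /\
    forall v w, `|v - u| < k.+1%:R^-1 -> `|w - u| < k.+1%:R^-1 ->
      N v /\ enorm (y v - y w) <= k%:R * enorm (v - w).
suff : \forall k \near \oo, K `<=` P k by move=> /filter_ex.
suff claim (x : 'rV[R]_n) : K x -> \forall u \near x & k \near \oo, P k u.
  by have /compact_near_coveringP/(_ nat \oo P) := cK; apply => x Kx; exact: claim.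
move=> Kx.
have [c Hc] := y_loclip (KN x Kx).
case: Hc => -[A B] /= [nA nB] Hc.
have nN : nbhs x N by apply: open_nbhs_nbhs; split => //; exact: KN.
have nABN : nbhs x (A `&` B `&` N) by apply: filterI => //; exact: filterI.
have /nbhs_ballP[e /= e0 He] := nABN.
have e20 : 0 < e / 2 by rewrite divr_gt0.
(* The first two terms bound [y] near [x], and the last dominates the local Lipschitz constant
   [c]. *)
pose b := enorm (y x) + `|c| * (n%:R * e) + `|c|.
have b0 : 0 <= b by rewrite !addr_ge0 ?enorm_ge0// mulr_ge0// mulr_ge0// ltW.
have nxe : \forall u \near x, `|u - x| < e / 2.
  apply/nbhs_ballP; exists (e / 2) => //= u.
  by rewrite -ball_normE /= distrC.
near=> u k.
have ux : `|u - x| < e / 2 by near: u; exact: nxe.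
have kb : b <= k%:R by near: k; exact: nbhs_infty_ger.
have ke : k.+1%:R^-1 < e / 2 by near: k; exact: (near_infty_natSinv_lt (PosNum e20)).
have c_le : c <= k%:R.
  apply: le_trans kb; apply: le_trans (ler_norm c) _.
  by rewrite lerDr addr_ge0 ?enorm_ge0// mulr_ge0// mulr_ge0// ltW.
have inB v : `|v - u| < e / 2 -> ball x e v.
  move=> vu; rewrite -ball_normE /= -(subrKA u) [e]splitr.
  by rewrite (le_lt_trans (ler_normD _ _))// ltrD// distrC.
split.
  have ue : ball x e u by apply: inB; rewrite subrr normr0.
  have xe : ball x e x by exact: ballxx.
  have := Hc (u, x) (conj (He u ue).1.1 (He x xe).1.2) => /= H.
  have := enormD (y u - y x) (y x); rewrite subrK => /le_trans; apply.
  apply: le_trans kb; rewrite addrC /b -addrA lerD2l.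
  rewrite -[leLHS]addr0 lerD//; apply: (le_trans H).
  apply: (@le_trans _ _ (`|c| * enorm (u - x))).
    by rewrite ler_wpM2r ?enorm_ge0// ler_norm.
  rewrite ler_wpM2l//; apply: le_trans (enorm_le_norm _) _.
  have uxe : `|u - x| <= e by apply: ltW; apply: (lt_le_trans ux); lra.
  by apply: ler_wpM2l.
move=> v w vu wu.
have ve := inB v (lt_trans vu ke); have we := inB w (lt_trans wu ke).
split; first exact: (He v ve).2.
have /= H := Hc (v, w) (conj (He v ve).1.1 (He w we).1.2).
by apply: (le_trans H); rewrite ler_wpM2r ?enorm_ge0.
Unshelve. all: by end_near. Qed.

(** [y] is globally Lipschitz on the neighbourhood [S] of [K]: pairs closer than [r] obey the local
    estimate, and for the others boundedness suffices. Each coordinate is then extended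
    separately. *)
Lemma local_extension (K : set 'rV[R]_n) : compact K -> K `<=` N ->
  exists (r L : R) (Y : 'rV[R]_n -> 'rV[R]_m), [/\ 0 < r,
    forall i u v, `|Y u 0 i - Y v 0 i| <= L * `|u - v| &
    forall u v, K u -> `|v - u| < r -> N v /\ y v = Y v].
Proof.
move=> cK KN; have [k Hk] := local_lipschitz_uniform cK KN.
pose r0 : R := k.+1%:R^-1; pose r := r0 / 2.
have r00 : 0 < r0 by rewrite invr_gt0.
have r0' : 0 < r by rewrite divr_gt0.
have rr0 : r < r0 by rewrite /r ltr_pdivrMr// ltr_pMr// ltr1n.
pose S := [set v | exists2 u, K u & `|v - u| < r].
have r_inv : 0 <= r^-1 by rewrite invr_ge0; exact: ltW.
have c0 : 0 <= 2 * (k%:R + k%:R * (n%:R * r)).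
  by rewrite mulr_ge0// addr_ge0// mulr_ge0// mulr_ge0// ltW.
(* The first summand handles close pairs; the second is twice the bound of [y] on [S], divided by
   the least distance [r] of a far pair. *)
pose L : R := k%:R * n%:R + 2 * (k%:R + k%:R * (n%:R * r)) / r.
have L0 : 0 <= L.
  by apply: addr_ge0; [exact: mulr_ge0|exact: mulr_ge0].
have yL i v w : S v -> S w -> `|y v 0 i - y w 0 i| <= L * `|v - w|.
  move=> [u Ku vu] [u' Ku' wu'].
  have -> : y v 0 i - y w 0 i = (y v - y w) 0 i by rewrite !mxE.
  apply: le_trans (enorm_coord _ i) _.
  have [vw|vw] := ltP `|v - w| r.
    have wu : `|w - u| < r0.
      rewrite -(subrKA v) (le_lt_trans (ler_normD _ _))// [r0]splitr ltrD//.
      by rewrite distrC.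
    have [_ H] := (Hk u Ku).2 v w (lt_trans vu rr0) wu.
    apply: (le_trans H); apply: (@le_trans _ _ (k%:R * n%:R * `|v - w|)).
      by rewrite -mulrA ler_wpM2l// enorm_le_norm.
    by apply: ler_wpM2r => //; rewrite /L lerDl; exact: mulr_ge0.
  have bd z q : K q -> `|z - q| < r -> enorm (y z) <= k%:R + k%:R * (n%:R * r).
    move=> Kq zq; have [yq H] := Hk q Kq.
    have qq : `|q - q| < k.+1%:R^-1 by rewrite subrr normr0.
    have [_ H1] := H z q (lt_trans zq rr0) qq.
    have := enormD (y z - y q) (y q); rewrite subrK => /le_trans; apply.
    rewrite addrC lerD//; apply: (le_trans H1); rewrite ler_wpM2l//.
    by apply: le_trans (enorm_le_norm _) _; rewrite ler_wpM2l// ltW.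
  apply: (@le_trans _ _ (2 * (k%:R + k%:R * (n%:R * r)))).
    have := enormD (y v) (- y w); rewrite enormN => /le_trans; apply.
    by rewrite mulr_natl mulr2n; apply: lerD; [exact: (bd _ u)|exact: (bd _ u')].
  apply: (@le_trans _ _ (2 * (k%:R + k%:R * (n%:R * r)) / r * `|v - w|)).
    by rewrite -mulrA ler_peMr// ler_pdivlMl// mulr1.
  by rewrite ler_wpM2r// /L lerDr mulr_ge0.
have [G HG] := choice (fun i => lipschitz_extension L0 (yL i)).
exists r, L, (fun v => \row_i G i v); split => //.
  by move=> i u v; rewrite !mxE; exact: (HG i).1.
move=> u v Ku vu; have [_ H] := Hk u Ku.
have uu : `|u - u| < k.+1%:R^-1 by rewrite subrr normr0.
split; first exact: (H v u (lt_trans vu rr0) uu).1.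
by apply/rowP => i; rewrite mxE (HG i).2//; exists u.
Qed.
End local_extension.

(** * Chain rule along a graph *)

Section partial_derivatives.
Context {R : realType} {U V : normedModType R}.
Variables (Phi : U * V -> R).

Lemma diff_partial1 u v : differentiable Phi (u, v) ->
  differentiable (fun z => Phi (z, v)) u /\
  forall h, 'd (fun z => Phi (z, v)) u h = 'd Phi (u, v) (h, 0).
Proof.
move=> dP; have dp : differentiable (fun z : U => (z, v)) u.
  by apply: differentiable_pair => //; exact: differentiable_cst.
have E : (fun z => Phi (z, v)) = Phi \o (fun z : U => (z, v)) by [].
split; first by rewrite E; exact: differentiable_comp.
have dI : differentiable (id : U -> U) u by [].
have dC : differentiable (cst v : U -> V) u by exact: differentiable_cst.
move=> h; rewrite E diff_comp//= (diff_pair dI dC).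
by rewrite diff_cst diff_val.
Qed.

Lemma diff_partial2 u v : differentiable Phi (u, v) ->
  differentiable (fun w => Phi (u, w)) v /\
  forall k, 'd (fun w => Phi (u, w)) v k = 'd Phi (u, v) (0, k).
Proof.
move=> dP; have dp : differentiable (fun w : V => (u, w)) v.
  by apply: differentiable_pair => //; exact: differentiable_cst.
have E : (fun w => Phi (u, w)) = Phi \o (fun w : V => (u, w)) by [].
split; first by rewrite E; exact: differentiable_comp.
have dI : differentiable (id : V -> V) v by [].
have dC : differentiable (cst u : V -> U) v by exact: differentiable_cst.
move=> h; rewrite E diff_comp//= (diff_pair dC dI).
by rewrite diff_cst diff_val.
Qed.

(** The differential of the graph map sends [h] to the pair of [h] and ['d y u h]; linearity splits
    it into the two partial directions. *)
Lemma diff_graph (y : U -> V) u : differentiable Phi (u, y u) ->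
  differentiable y u ->
  differentiable (fun z => Phi (z, y z)) u /\
  forall h, 'd (fun z => Phi (z, y z)) u h =
    'd (fun z => Phi (z, y u)) u h + 'd (fun w => Phi (u, w)) (y u) ('d y u h).
Proof.
move=> dP dy; have dp : differentiable (fun z : U => (z, y z)) u.
  exact: differentiable_pair.
have E : (fun z => Phi (z, y z)) = Phi \o (fun z : U => (z, y z)) by [].
split; first by rewrite E; exact: differentiable_comp.
move=> h.
have H1 := (diff_partial1 dP).2 h; have H2 := (diff_partial2 dP).2 ('d y u h).
apply: etrans _ (esym (congr2 +%R H1 H2)).
have dI : differentiable (id : U -> U) u by [].
rewrite E diff_comp//= (diff_pair dI dy) diff_val -linearD; congr ('d Phi _ _).
by apply/pair_eqP; rewrite /= addr0 add0r !eqxx.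
Qed.
End partial_derivatives.

Lemma cvg_row (R : realType) n (f : nat -> 'rV[R]_n) (l : 'rV[R]_n) :
  (forall j, f k 0 j @[k --> \oo] --> l 0 j) -> f k @[k --> \oo] --> l.
Proof.
move=> H; apply/cvgrPdist_le => e e0.
have : \forall k \near \oo, forall j, `|l 0 j - f k 0 j| <= e.
  by apply: filter_forall => j; have /cvgrPdist_le := H j; exact.
apply: filterS => k Hk; rewrite ler_row_norm ?(ltW e0)//.
by apply/forallP => j; rewrite !mxE.
Qed.

Lemma cvg_sumr (R : realType) (I : Type) (s : seq I) (f : I -> nat -> R) (l : I -> R) :
  (forall i, f i k @[k --> \oo] --> l i) ->
  \sum_(i <- s) f i k @[k --> \oo] --> \sum_(i <- s) l i.
Proof.
move=> H; elim: s => [|i s IH].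
  rewrite big_nil (_ : (fun k => _) = cst 0); first exact: cvg_cst.
  by apply/funext => k; rewrite big_nil.
rewrite big_cons (_ : (fun k => _) = fun k => f i k + \sum_(i <- s) f i k).
  by apply: cvgD.
by apply/funext => k; rewrite big_cons.
Qed.

(** * Hypergradients *)

Section clarke_chain.
Context {R : realType} {n m : nat}.
Variables (phi : 'rV[R]_n -> 'rV[R]_m -> R) (y : 'rV[R]_n -> 'rV[R]_m).
Hypothesis phi_C1 : C1 phi.

Let Phi (q : 'rV[R]_n * 'rV[R]_m) : R := phi q.1 q.2.

Let dPhi p : differentiable Phi p.
Proof. by case: phi_C1. Qed.

Lemma JacE (h : 'rV[R]_n -> 'rV[R]_m) x i j :
  Jac h x i j = 'd h x (delta_mx 0 j) 0 i.
Proof. by rewrite /Jac mxE /jacobian mxE. Qed.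

Lemma differentiable_hyperobjective u : differentiable y u ->
  differentiable (hyperobjective phi y) u.
Proof. by move=> dy; have [] := diff_graph (dPhi (u, y u)) dy. Qed.

Lemma grad_hyperobjective u : differentiable y u ->
  grad (hyperobjective phi y) u = grad1 phi u (y u) + grad2 phi u (y u) *m Jac y u.
Proof.
move=> dy; have [dH HE] := diff_graph (dPhi (u, y u)) dy.
have [d1 _] := diff_partial1 (dPhi (u, y u)).
have [d2 _] := diff_partial2 (dPhi (u, y u)).
apply/rowP => j.
have -> : grad (hyperobjective phi y) u 0 j = 'd (hyperobjective phi y) u (delta_mx 0 j).
  by rewrite mxE; apply: deriveE.
apply: etrans (HE _) _.
have E1 := diff_grad (delta_mx 0 j) d1; have E2 := diff_grad ('d y u (delta_mx 0 j)) d2.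
apply: etrans (congr2 +%R E1 E2) _.
rewrite dot_delta [RHS]mxE; congr (_ + _).
rewrite [RHS]mxE; apply: eq_bigr => i _; congr (_ * _).
by rewrite JacE.
Qed.

(** The map from [V] to [dx + dy V] is affine, so the preimage of the convex subdifferential is
    convex and only limits of Jacobians need checking. The sequence defining such a limit also
    serves the hyperobjective, which is differentiable wherever [y] is; its gradients converge
    because the partial gradients of [phi] are continuous. *)
Lemma clarke_jac_sub_subdiff (N : set 'rV[R]_n) (x : 'rV[R]_n) :
  {for x, continuous y} ->
  clarke_jac N y x `<=`
    [set V | clarke_subdiff N (hyperobjective phi y) x (dx phi y x + dy phi y x *m V)].
Proof.
move=> cy; apply: conv_hull_sub.
  apply/convex_setP => A B s s01 HA HB /=.
  have -> : dx phi y x + dy phi y x *m (s *: A + (1 - s) *: B) =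
      s *: (dx phi y x + dy phi y x *m A) + (1 - s) *: (dx phi y x + dy phi y x *m B).
    rewrite mulmxDr -!scalemxAr !scalerDr addrACA -scalerDl.
    by rewrite [s + _]addrC subrK scale1r.
  have /convex_setP cS : convex_set (clarke_subdiff N (hyperobjective phi y) x).
    exact: conv_hull_convex.
  exact: cS.
move=> V [xk [Nxk xkx JV]]; apply: sub_conv_hull; exists xk; split => //.
  move=> k; have [Nk dk] := Nxk k; split => //; exact: differentiable_hyperobjective.
have yk : y (xk k) @[k --> \oo] --> y x.
  by apply: cvg_comp xkx _; exact: cy.
have pk : (xk k, y (xk k)) @[k --> \oo] --> (x, y x).
  exact: (cvg_pair xkx yk).
have [_ c1 c2] := phi_C1.
have g1 : grad1 phi (xk k) (y (xk k)) @[k --> \oo] --> dx phi y x.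
  exact: (@cvg_comp _ _ _ (fun k => (xk k, y (xk k)))
    (fun q : 'rV[R]_n * 'rV[R]_m => grad1 phi q.1 q.2) _ _ _ pk (c1 (x, y x))).
have g2 : grad2 phi (xk k) (y (xk k)) @[k --> \oo] --> dy phi y x.
  exact: (@cvg_comp _ _ _ (fun k => (xk k, y (xk k)))
    (fun q : 'rV[R]_n * 'rV[R]_m => grad2 phi q.1 q.2) _ _ _ pk (c2 (x, y x))).
apply: cvg_row => j.
have E k : grad (hyperobjective phi y) (xk k) 0 j =
   grad1 phi (xk k) (y (xk k)) 0 j + \sum_i grad2 phi (xk k) (y (xk k)) 0 i * Jac y (xk k) i j.
  by rewrite grad_hyperobjective; [rewrite mxE; congr (_ + _); rewrite mxE|case: (Nxk k)].
rewrite (_ : (fun k => _) = fun k => grad1 phi (xk k) (y (xk k)) 0 j +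
  \sum_i grad2 phi (xk k) (y (xk k)) 0 i * Jac y (xk k) i j); last exact/funext.
have -> : (dx phi y x + dy phi y x *m V) 0 j =
    dx phi y x 0 j + \sum_i dy phi y x 0 i * V i j.
  by rewrite mxE; congr (_ + _); rewrite mxE.
have coord p q (A : nat -> 'M[R]_(p, q)) (B : 'M[R]_(p, q)) i l :
    A k @[k --> \oo] --> B -> A k i l @[k --> \oo] --> B i l.
  move=> AB; exact: (@cvg_comp _ _ _ A (fun M => M i l) _ _ _ AB (@coord_continuous _ _ _ i l B)).
apply: cvgD; first exact: coord.
by apply: cvg_sumr => i; apply: cvgM; exact: coord.
Qed.
End clarke_chain.

Section hypergradient.
Context {R : realType} {n m : nat}.
Variables (phi : 'rV[R]_n -> 'rV[R]_m -> R) (y : 'rV[R]_n -> 'rV[R]_m).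
Variables (N : set 'rV[R]_n) (x : 'rV[R]_n) (delta : R).
Hypotheses (phi_C1 : C1 phi) (N_open : open N) (y_loclip : locally_lipschitz N y).
Hypotheses (delta_gt0 : 0 < delta) (ballN : eball x delta `<=` N).

Lemma compact_eball (z : 'rV[R]_n) (r : R) : compact (eball z r).
Proof.
apply: bounded_closed_compact; last exact: closed_eball.
exists (enorm z + r); split; first exact: num_real.
move=> M HM u uz /=; apply: le_trans (ltW HM); apply: le_trans (norm_le_enorm u) _.
by have := enormD (u - z) z; rewrite subrK addrC => /le_trans; apply; rewrite lerD2l.
Qed.

Lemma eball_center (r : R) : 0 <= r -> eball x r x.
Proof. by rewrite /eball /= subrr enorm0. Qed.

Let local_data : exists (r L : R) (Y : 'rV[R]_n -> 'rV[R]_m), [/\ 0 < r,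
    forall i u v, `|Y u 0 i - Y v 0 i| <= L * `|u - v| &
    forall u v, eball x delta u -> `|v - u| < r -> N v /\ y v = Y v].
Proof. exact: (local_extension N_open y_loclip (@compact_eball x delta) ballN). Qed.

Lemma near_ball_eq (r : R) (f g : 'rV[R]_n -> 'rV[R]_m) (u v : 'rV[R]_n) :
  (forall w, `|w - u| < r -> f w = g w) -> `|v - u| < r ->
  \forall w \near v, f w = g w.
Proof.
move=> H vu; apply/nbhs_ballP; exists (r - `|v - u|) => /=; first by rewrite subr_gt0.
move=> w; rewrite -ball_normE /= => vw; apply: H.
by rewrite -(subrKA v) (le_lt_trans (ler_normD _ _))// -ltrBrDr distrC.
Qed.

Lemma Jac_bounded_near : exists (r M : R), 0 < r /\
  forall u, `|u - x| < r -> N u -> differentiable y u -> `|Jac y u| <= M.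
Proof.
have [r [L [Y [r0 YL Yy]]]] := local_data.
exists r, `|L|; split => // u ux Nu dy.
have H w : `|w - x| < r -> y w = Y w.
  by move=> wx; have [] := Yy x w (eball_center (ltW delta_gt0)) wx.
have [dY JE'] := near_eq_Jac (near_ball_eq H ux) dy.
suff : `|Jac Y u| <= `|L| by rewrite JE'.
apply: mx_norm_le; first exact: normr_ge0.
move=> i j.
have rowE (A : 'M[R]_(m, n)) : row i A 0 j = A i j by rewrite mxE.
rewrite -[Jac Y u i j]rowE -(grad_coord i dY).
apply: le_trans (ler_norm L).
exact: (grad_lipschitz j (YL i) (differentiable_coord_row i dY)).
Qed.

Lemma continuous_response : {for x, continuous y}.
Proof.
have [r [L [Y [r0 YL Yy]]]] := local_data.
have cY : {for x, continuous Y}.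
  apply: (@lipschitz_norm_continuous _ _ _ Y `|L|) => u v.
  rewrite ler_row_norm ?mulr_ge0//; apply/forallP => i; rewrite !mxE.
  by apply: (le_trans (YL i u v)); rewrite ler_wpM2r// ler_norm.
have H w : `|w - x| < r -> Y w = y w.
  by move=> wx; have [] := Yy x w (eball_center (ltW delta_gt0)) wx.
have xx : `|x - x| < r by rewrite subrr normr0.
have E := near_ball_eq H xx.
have cY' : Y z @[z --> x] --> y x by rewrite -(H x xx); exact: cY.
exact: (cvg_trans (near_eq_cvg E) cY').
Qed.

Lemma near_differentiable (r : R) : 0 < r -> exists u,
  [/\ `|u - x| < r, N u & differentiable y u].
Proof.
move=> r0; have [r1 [L [Y [r10 YL Yy]]]] := local_data.
pose d := Num.min (r / 2) (r1 / 2).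
have d0 : 0 < d by rewrite lt_min !divr_gt0.
have [s sx dY] := ex_differentiable x YL d0.
have sd : `|s - x| <= d by exact: le_trans (norm_le_enorm _) sx.
have sr : `|s - x| < r.
  by apply: (le_lt_trans sd); rewrite gt_min ltr_pdivrMr// ltr_pMr// ltr1n.
have sr1 : `|s - x| < r1.
  by apply: (le_lt_trans sd); rewrite gt_min orbC ltr_pdivrMr// ltr_pMr// ltr1n.
have xd := eball_center (ltW delta_gt0).
exists s; split => //; first by have [] := Yy x s xd sr1.
have H w : `|w - x| < r1 -> Y w = y w by move=> wx; have [] := Yy x w xd wx.
by have [] := near_eq_Jac (near_ball_eq H sr1) dY.
Qed.

(** Rademacher's theorem gives points of differentiability arbitrarily near [x], and local
    boundedness of the Jacobians gives a limit near one of theirs. *)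
Lemma clarke_jac_neq0 : clarke_jac N y x !=set0.
Proof.
have [r [M [r0 JM]]] := Jac_bounded_near.
have [rho rho0 H] := jac_limits_near r0 JM ltr01.
have [u [ux Nu dy]] := near_differentiable rho0.
by have [V LV _] := H u ux Nu dy; exists V; exact: sub_conv_hull.
Qed.

(** A supremum over an empty family would be minus infinity; nonemptiness of the Clarke Jacobian at
    [x] rules this out. *)
Lemma clarke_variation_ge0 : (0 <= clarke_variation N y x delta)%E.
Proof.
have [V KV] := clarke_jac_neq0.
apply: (@le_trans _ _ (set_dist (@opnorm R m n) V (clarke_jac N y x))).
  by apply: set_dist_ge0; exact: opnorm_ge0.
apply: (@le_trans _ _ (ereal_sup [set set_dist (@opnorm R m n) V (clarke_jac N y x)
                           | V in clarke_jac N y x])).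
  by apply: ereal_sup_ubound; exists V.
apply: ereal_sup_ubound; exists x => //; exact: eball_center (ltW delta_gt0).
Qed.

(** Equality at [x] alone would not transfer Jacobians. For [u] within [r] of [x], each sample point
    [u + delta xi] is within [r] of the point [x + delta xi] of the ball, where [y] and [Y]
    agree. *)
Let smoothing_eq (r : R) (Y : 'rV[R]_n -> 'rV[R]_m) : 0 < r ->
  (forall u v, eball x delta u -> `|v - u| < r -> N v /\ y v = Y v) ->
  \forall u \near x, smoothing Y delta u = smoothing y delta u.
Proof.
move=> r0 Yy; apply/nbhs_ballP; exists r => //= u; rewrite -ball_normE /= => xu.
apply/rowP => j; rewrite !mxE /unif_ball_mean; congr (_ * _).
apply: eq_Rintegral => t /set_mem; rewrite /eball /= subr0 => t1.
have tx : eball x delta (x + delta *: row_of_tuple t).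
  by rewrite /eball /= addrAC subrr add0r enormZ gtr0_norm// ler_piMr// ltW.
have tu : `|u + delta *: row_of_tuple t - (x + delta *: row_of_tuple t)| < r.
  by rewrite opprD addrACA subrr addr0 distrC.
by rewrite (Yy _ _ tx tu).2.
Qed.

(** A real upper bound [r] replaces the extended-real variation. The convex set [C] is the
    neighbourhood of radius [|w| (r + e')] of the image of the Clarke Jacobian; it contains [w]
    times every Jacobian in the ball, hence almost contains their mean. *)
Lemma set_dist_approx_hypergrad_fin (r : R) :
  (clarke_variation N y x delta <= r%:E)%E ->
  (set_dist (@enorm R n) (approx_hypergrad phi y delta x)
     (clarke_subdiff N (hyperobjective phi y) x) <= (enorm (dy phi y x) * r)%:E)%E.
Proof.
move=> wr; have [r1 [L [Y [r10 YL Yy]]]] := local_data.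
set w := dy phi y x.
apply/lee_addgt0Pr => e e0.
(* The mean is approximated by [C] up to [e'] and the distances in the variation are attained up to
   [e'], which costs [(|w| + 1) e'] in all, at most [c * e']. *)
pose c := enorm w + 2.
have c0 : 0 < c by rewrite ltr_wpDl ?enorm_ge0.
pose e' := e / c.
have e'0 : 0 < e' by rewrite divr_gt0.
have cE : c * e' = e by rewrite /e' mulrC divfK// gt_eqF.
pose C := [set a : 'rV[R]_n | exists2 v, [set w *m V | V in clarke_jac N y x] v &
  enorm (a - v) <= enorm w * (r + e')].
have cC : convex_set C.
  apply: near_convex => [|a v|]; [exact: enormD|by rewrite enormZ|].
  apply/convex_setP => _ _ s s01 [V KV <-] [V' KV' <-].
  have /convex_setP cK := @clarke_jac_convex R n m N y x.
  exists (s *: V + (1 - s) *: V'); first exact: cK.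
  by rewrite mulmxDr -!scalemxAr.
have CJ s : eball x delta s -> differentiable Y s -> C (w *m Jac Y s).
  move=> sx dY.
  have H z : `|z - s| < r1 -> Y z = y z by move=> zs; have [] := Yy s z sx zs.
  have ss : `|s - s| < r1 by rewrite subrr normr0.
  have [dys JEs] := near_eq_Jac (near_ball_eq H ss) dY.
  have Ns : N s by exact: ballN.
  have KJ := clarke_jac_Jac Ns dys.
  have [|V KV HV] := @set_dist_opnorm_lt R n m (Jac y s) (clarke_jac N y x) (r + e').
    apply: (@le_lt_trans _ _ r%:E); last by rewrite lte_fin ltrDl.
    apply: le_trans wr.
    apply: (@le_trans _ _ (ereal_sup [set set_dist (@opnorm R m n) V (clarke_jac N y x)
                           | V in clarke_jac N y s])).
      by apply: ereal_sup_ubound; exists (Jac y s).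
    by apply: ereal_sup_ubound; exists s.
  exists (w *m V); first by exists V.
  rewrite -JEs -mulmxBr; apply: le_trans (enorm_mulmx_opnorm _ _) _.
  by apply: ler_wpM2l; [exact: enorm_ge0|exact: (ltW HV)].
have [P [_ [V KV <-] HV] HP] := smoothing_jac_near YL delta_gt0 cC CJ e'0.
have SV : clarke_subdiff N (hyperobjective phi y) x (dx phi y x + dy phi y x *m V) :=
    clarke_jac_sub_subdiff phi_C1 continuous_response KV.
apply: le_trans (set_dist_le _ _ SV) _; rewrite -EFinD lee_fin.
have [_ JE] := near_eq_Jac (smoothing_eq r10 Yy) (differentiable_smoothing x YL delta_gt0).
rewrite /approx_hypergrad JE -/w; clear JE.
rewrite opprD addrACA subrr add0r.
rewrite -(subrKA P); apply: (le_trans (enormD _ _)).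
apply: (le_trans (lerD (ltW HP) HV)).
rewrite mulrDr addrCA lerD2l.
apply: (@le_trans _ _ (c * e')); first by rewrite /c; nra.
rewrite cE; exact: lexx.
Qed.

Lemma set_dist_approx_hypergrad :
  (set_dist (@enorm R n) (approx_hypergrad phi y delta x)
     (clarke_subdiff N (hyperobjective phi y) x)
   <= (enorm (dy phi y x))%:E * clarke_variation N y x delta)%E.
Proof.
have := clarke_variation_ge0; have := set_dist_approx_hypergrad_fin.
case: (clarke_variation N y x delta) => [r H _| _ _|//].
  by rewrite -EFinM; exact: H.
(* With infinite variation the right side is infinite unless [dy] vanishes, when the product is 0 by
   convention. Then the approximate hypergradient is [dx], which belongs to the subdifferential. *)
have [w0|w0] := eqVneq (enorm (dy phi y x)) 0.
  rewrite w0 mul0e; have [V KV] := clarke_jac_neq0.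
  have SV : clarke_subdiff N (hyperobjective phi y) x (dx phi y x + dy phi y x *m V) :=
    clarke_jac_sub_subdiff phi_C1 continuous_response KV.
  apply: le_trans (set_dist_le _ _ SV) _.
  by rewrite /approx_hypergrad (enorm_eq0 w0) !mul0mx subrr enorm0.
by rewrite gt0_muley ?leey// lte_fin lt_neqAle eq_sym w0 enorm_ge0.
Qed.
End hypergradient.

Lemma nonneg_ereal_cvg0 (R : realType) (T : Type) (F : set_system T)
    (f : T -> \bar R) : Filter F ->
  (forall e : R, 0 < e -> \forall t \near F, (0 <= f t <= e%:E)%E) ->
  f t @[t --> F] --> 0%:E.
Proof.
move=> FF H; apply/fine_cvgP; split.
  apply: filterS (H 1 ltr01) => t /andP[f0 f1].
  by rewrite ge0_fin_numE// (le_lt_trans f1)// ltry.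
apply/cvgrPdist_le => e e0; apply: filterS (H e e0) => t /andP[f0 fe] /=.
have ft : f t \is a fin_num by rewrite ge0_fin_numE// (le_lt_trans fe)// ltry.
by rewrite sub0r normrN ger0_norm ?fine_ge0// -lee_fin fineK.
Qed.

Lemma eball_sub_thickening (R : realType) n (X : set 'rV[R]_n) x (delta r : R) :
  X x -> 0 < delta <= r -> eball x delta `<=` thickening X r.
Proof.
move=> Xx /andP[d0 dr] u ux; have r0 : 0 < r := lt_le_trans d0 dr.
exists x => //; exists (r^-1 *: (u - x)); last first.
  by rewrite scalerA divff ?gt_eqF// scale1r addrC subrK.
rewrite /eball /= subr0 enormZ gtr0_norm ?invr_gt0// mulrC ler_pdivrMr// mul1r.
exact: (le_trans ux dr).
Qed.

Theorem proposition3 (R : realType) (n m : nat)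
  (X N : set 'rV[R]_n) (Y : set 'rV[R]_m)
  (g : 'rV[R]_n -> 'rV[R]_m -> R) (y : 'rV[R]_n -> 'rV[R]_m)
  (deltabar Ymax Ly : R)
  (phi : 'rV[R]_n -> 'rV[R]_m -> R)
  (W : set ('rV[R]_n * 'rV[R]_m)) (L1x L1y L2x L2y My : R)
  (X_nonempty : X !=set0)
  (X_compact : compact X)
  (N_open : open N)
  (XN : X `<=` N)
  (y_response : forall x, N x -> argmin Y (g x) = [set y x])
  (y_loclip : locally_lipschitz N y)
  (deltabar_gt0 : 0 < deltabar)
  (thickN : thickening X deltabar `<=` N)
  (y_bounded : forall u, thickening X deltabar u -> enorm (y u) <= Ymax)
  (y_lipschitz : forall u v, thickening X deltabar u ->
     thickening X deltabar v -> enorm (y u - y v) <= Ly * enorm (u - v))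
  (phi_C1 : C1 phi)
  (W_y : forall x, X x -> W (x, y x))
  (W_smoothing : forall x (delta : R), X x -> 0 < delta <= deltabar ->
     W (x, smoothing y delta x))
  (L1x_gt0 : 0 < L1x) (L1y_gt0 : 0 < L1y)
  (L2x_gt0 : 0 < L2x) (L2y_gt0 : 0 < L2y) (My_gt0 : 0 < My)
  (grad1_lipschitz : forall x v x' v', W (x, v) -> W (x', v') ->
     enorm (grad1 phi x v - grad1 phi x' v')
       <= L1x * enorm (x - x') + L1y * enorm (v - v'))
  (grad2_lipschitz : forall x v x' v', W (x, v) -> W (x', v') ->
     enorm (grad2 phi x v - grad2 phi x' v')
       <= L2x * enorm (x - x') + L2y * enorm (v - v'))
  (grad2_bounded : forall x v, W (x, v) -> enorm (grad2 phi x v) <= My) :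
  (forall x, X x -> forall delta : R, 0 < delta <= deltabar ->
     (set_dist (@enorm R n) (approx_hypergrad phi y delta x)
            (clarke_subdiff N (hyperobjective phi y) x)
      <= (enorm (dy phi y x))%:E * clarke_variation N y x delta)%E) /\
  (forall x, X x ->
     set_dist (@enorm R n) (approx_hypergrad phi y delta x)
           (clarke_subdiff N (hyperobjective phi y) x)
       @[delta --> 0^'+] --> 0%:E).
Proof.
have ballN x delta : X x -> 0 < delta <= deltabar -> eball x delta `<=` N.
  by move=> Xx d u ux; apply: thickN; exact: (eball_sub_thickening Xx d ux).
have bound x : X x -> forall delta : R, 0 < delta <= deltabar ->
    (set_dist (@enorm R n) (approx_hypergrad phi y delta x)
       (clarke_subdiff N (hyperobjective phi y) x)
     <= (enorm (dy phi y x))%:E * clarke_variation N y x delta)%E.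
  move=> Xx delta d; have /andP[d0 _] := d.
  exact: (set_dist_approx_hypergrad phi_C1 N_open y_loclip d0 (ballN _ _ Xx d)).
split=> // x Xx; apply: nonneg_ereal_cvg0 => e e0.
have db : 0 < deltabar <= deltabar by rewrite deltabar_gt0 lexx.
have [r [M [r0 JM]]] := Jac_bounded_near N_open y_loclip deltabar_gt0 (ballN _ _ Xx db).
(* Adding 1 avoids a division by zero when [dy] vanishes and still gives [|dy| * (e / c) <= e]. *)
pose c := enorm (dy phi y x) + 1.
have c0 : 0 < c by rewrite ltr_wpDl ?enorm_ge0.
have [rho rho0 Hrho] := clarke_variation_le r0 JM (divr_gt0 e0 c0).
near=> delta.
have d0 : 0 < delta by near: delta; exact: nbhs_right_gt.
have d : 0 < delta <= deltabar.
  by apply/andP; split; [exact: d0|near: delta; exact: nbhs_right_le].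
apply/andP; split; first by apply: set_dist_ge0; exact: enorm_ge0.
apply: (le_trans (bound x Xx delta d)).
have drho : delta < rho by near: delta; exact: nbhs_right_lt.
apply: (@le_trans _ _ ((enorm (dy phi y x))%:E * (e / c)%:E)%E).
  by apply: lee_wpmul2l; [rewrite lee_fin; exact: enorm_ge0|exact: Hrho].
rewrite -EFinM lee_fin mulrA ler_pdivrMr// mulrC ler_pM2l// /c lerDl; exact: ler01.
Unshelve. all: by end_near.
Qed.
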